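(* Let $k$ be a positive integer, let $n\ge 2k$, and let $(A_j)$ be any one of the nine families of subalgebras $P_j(n),\ \mathbb{C}S_j,\ B_j(n),\ R_j(n),\ RB_j(n),\ TL_j(n),\ M_j(n),\ PR_j(n),\ PP_j(n)$ of the partition algebras $P_j(n)$. Let $\lambda,\mu\vdash n$, and let $\phi$ be the map defined in the context. (1) If $T\in\mathrm{SMT}_{A_k}(\lambda)$ and $\phi(T)=(S,\tau)$, where $S$ has shape $\mu$, then $S\in\mathrm{SMT}_{A_{k-1}}(\mu)$. (2) For each $S\in\mathrm{SMT}_{A_{k-1}}(\mu)$, the number of $T\in\mathrm{SMT}_{A_k}(\lambda)$ such that $\phi(T)=(S,\tau)$ for some partition $\tau$ is equal to the number of edges from $\overline\mu$ (at level $k-1$) to $\overline\lambda$ (at level $k$) in the Bratteli diagram for the tower of algebras $A_0\subseteq A_1\subseteq A_2\subseteq\cdots$.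
   Context: **Partitions and tableaux.** $[k]=\{1,\ldots,k\}$, $[0]=\emptyset$. For a partition $\lambda=(\lambda_1,\lambda_2,\ldots,\lambda_r)$, $\overline\lambda=(\lambda_2,\ldots,\lambda_r)$. Its diagram has $\lambda_j$ left-justified cells in row $j$; row $1$ is the first row. Last letter order: for disjoint non-empty sets $X,Y\subseteq[k]$, $X<Y$ if $\max X<\max Y$; the empty set is smaller than every non-empty set. $\mathrm{SMT}(\lambda,k)$ is the set of standard multiset tableaux of shape $\lambda$ and content $[k]$: fillings of the cells of $\lambda$ by subsets of $[k]$ (the empty set may label several cells, called blank cells) such that every letter of $[k]$ lies in exactly one entry, entries weakly increase along rows from left to right, and strictly increase in each column from row $j$ to row $j+1$. A standard multiset tableau is *matching* if its first row contains only sets of size at most $2$ and all other rows contain only sets of size $1$. Two sets $X,X'$ are *non-crossing* if there are no $a,b\in X$, $c,d\in X'$ with $a<c<b<d$ or $c<a<d<b$; a letter $c$ is *between* a set $X$ if there are $a,b\in X$ with $a<c<b$. A standard multiset tableau is *planar* if it has at most two rows, the sets in its first row are pairwise non-crossing, and no element belonging to a set in the second row is between any set in the tableau (apart from the set containing that element). $\mathrm{SMT}_{A_k}(\lambda)$ is the set of $T\in\mathrm{SMT}(\lambda,k)$ such that: for $P_k(n)$, no condition; for $PP_k(n)$, planar; for $\mathbb{C}S_k$, matching with first-row entries all of size $0$; for $B_k(n)$, matching with first-row entries of sizes in $\{0,2\}$; for $R_k(n)$, matching with first-row sizes in $\{0,1\}$; for $RB_k(n)$, matching with first-row sizes in $\{0,1,2\}$;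 for $TL_k(n)$, matching and planar with first-row sizes in $\{0,2\}$; for $M_k(n)$, matching and planar with first-row sizes in $\{0,1,2\}$; for $PR_k(n)$, matching and planar with first-row sizes in $\{0,1\}$. **The map $\phi$.** Row insertion of $x$ into a tableau starting at row $r$: if $x$ is greater than or equal to all entries of row $r$ (including the case of an empty row), append $x$ at the end of row $r$; otherwise replace the leftmost entry $\hat x>x$ of row $r$ by $x$ and insert $\hat x$ starting at row $r+1$ in the same way. For $T\in\mathrm{SMT}(\lambda,k)$, let $A$ be the entry of $T$ containing $k$ (its cell is a corner of $\lambda$), and let $T'$ be obtained by deleting that cell; let $\tau$ be the shape of $T'$. If $A\ne\{k\}$, let $S$ be obtained by row inserting $A\setminus\{k\}$ into $T'$ starting at row $2$. If $A=\{k\}$, let $S$ be obtained from $T'$ by adding a blank cell at the beginning of its first row. Then $\phi(T)=(S,\tau)$. **Algebras.** $P_k(n)$ is the partition algebra with basis the set partitions (diagrams) of $[k]\cup\{\overline1,\ldots,\overline k\}$. The families are the subalgebras spanned by: all diagrams ($P_k(n)$); permutations ($\mathbb{C}S_k$); perfect matchings (Brauer, $B_k(n)$); partial permutations (rook, $R_k(n)$); matchings (rook-Brauer, $RB_k(n)$); planar perfect matchings (Temperley–Lieb, $TL_k(n)$); planar matchings (Motzkin, $M_k(n)$); planar partial permutations (planar rook, $PR_k(n)$); planar diagrams (planar algebra, $PP_k(n)$). Here a matching has all blocks of size at most $2$, a perfect matching has all blocks of size $2$, a partial permutation is a matching whose blocks of size $2$ all meet both $[k]$ and $\{\overline1,\ldots,\overline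 k\}$, and a permutation is a perfect matching that is a partial permutation; planar means drawable without crossings inside the rectangle with $1,\ldots,k$ on the top row and $\overline1,\ldots,\overline k$ on the bottom row. **Bratteli diagram.** Its level-$k$ vertices are the irreducible representations of $A_k$, and the number of edges from $V$ at level $k-1$ to $V'$ at level $k$ is the multiplicity of $V$ in the restriction of $V'$ to $A_{k-1}$. The irreducibles of $A_k$ are indexed by partitions $\nu$ as follows: $P_k(n), R_k(n), RB_k(n)$: $0\le|\nu|\le k$; $\mathbb{C}S_k$: $|\nu|=k$; $B_k(n)$: $|\nu|=k-2r$, $0\le 2r\le k$; $TL_k(n)$: $\nu=(k-2r)$, $0\le 2r\le k$; $M_k(n), PR_k(n), PP_k(n)$: $\nu=(m)$, $0\le m\le k$ (with $(0)=\emptyset$). The known branching rules describing the edges between $\nu'$ in the index set at level $k-1$ and $\nu$ in the index set at level $k$ are (all partitions involved having at most one row for $TL,M,PR,PP$; there are no edges to or from partitions not in the index sets): - $P_k(n)$, $PP_k(n)$: the number of edges is the number of $\rho$ such that $\rho$ is obtained from $\nu$ by removing $1$ or $0$ cells and $\nu'$ is obtained from $\rho$ by adding $1$ or $0$ cells; - $\mathbb{C}S_k$: one edge if $\nu'$ is obtained from $\nu$ by removing a cell; - $B_k(n)$, $TL_k(n)$: one edge if $\nu'$ is obtained from $\nu$ by adding or removing a cell; - $R_k(n)$, $PR_k(n)$: one edge if $\nu'$ is obtained from $\nu$ by removing $1$ or $0$ cells; - $RB_k(n)$, $M_k(n)$: one edge if $\nu'=\nu$ or $\nu'$ is obtained from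 $\nu$ by adding or removing one cell; and no edges otherwise. *)

(* Defs.v *)
From mathcomp Require Import all_boot all_order all_algebra.
From mathcomp Require Export finmap.

Set Implicit Arguments.
Unset Strict Implicit.
Unset Printing Implicit Defensive.

Import GRing.Theory.

Local Open Scope nat_scope.

Inductive algebra_family := P_ | CS_ | B_ | R_ | RB_ | TL_ | M_ | PR_ | PP_.

(** * Partitions *)

(* Without trailing zeros, so that a partition has a unique representation;
   the partition with first part removed is [behead]. *)
Definition is_part (nu : seq nat) : bool := sorted geq nu && (0 \notin nu).

Definition part_of (n : nat) (nu : seq nat) : bool :=
  is_part nu && (sumn nu == n).

(** * Multiset tableaux *)

(* A tableau is the sequence of its rows, the first row coming first. *)
Definition tableau := seq (seq {fset nat}).

Definition row1 (T : tableau) : seq {fset nat} := nth [::] T 0.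
Definition row2 (T : tableau) : seq {fset nat} := nth [::] T 1.

(* Letters are positive, so max_letter X = 0 exactly when X is empty, and
   set_lt places the empty set below every non-empty one. *)
Definition max_letter (X : {fset nat}) : nat := \max_(c <- X) c.
Definition set_lt (X Y : {fset nat}) : bool := max_letter X < max_letter Y.
Definition set_le (X Y : {fset nat}) : bool := (X == Y) || set_lt X Y.

Definition content (k : nat) (T : tableau) : bool :=
  all (fun X : {fset nat} => all (fun c => 0 < c <= k) X) (flatten T) &&
  all (fun c => count (fun X : {fset nat} => c \in X) (flatten T) == 1)
      (iota 1 k).

Definition column_strict (r s : seq {fset nat}) : bool :=
  all (fun p => set_lt p.1 p.2) (zip r s).

Definition SMT (lam : seq nat) (k : nat) (T : tableau) : bool :=
  [&& shape T == lam, content k T, all (sorted set_le) T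
    & sorted column_strict T].

Definition matching_tableau (T : tableau) : bool :=
  all (fun X : {fset nat} => #|` X| <= 2) (row1 T) &&
  all (all (fun X : {fset nat} => #|` X| == 1)) (behead T).

Definition crossing (X Y : {fset nat}) : bool :=
  has (fun a => has (fun c => has (fun b => has (fun d =>
    [&& a < c, c < b & b < d]) Y) X) Y) X.

Definition noncrossing (X Y : {fset nat}) : bool :=
  ~~ crossing X Y && ~~ crossing Y X.

Definition between (c : nat) (X : {fset nat}) : bool :=
  has (fun a => a < c) X && has (fun b => c < b) X.

Definition planar_tableau (T : tableau) : bool :=
  [&& size T <= 2, pairwise noncrossing (row1 T)
    & all (fun Y : {fset nat} => all (fun c =>
        all (fun X => (X == Y) || ~~ between c X) (flatten T)) Y) (row2 T)].

Definition row1_sizes (s : seq nat) (T : tableau) : bool :=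
  all (fun X : {fset nat} => #|` X| \in s) (row1 T).

Definition tableau_in (A : algebra_family) (T : tableau) : bool :=
  match A with
  | P_  => true
  | PP_ => planar_tableau T
  | CS_ => matching_tableau T && row1_sizes [:: 0] T
  | B_  => matching_tableau T && row1_sizes [:: 0; 2] T
  | R_  => matching_tableau T && row1_sizes [:: 0; 1] T
  | RB_ => matching_tableau T && row1_sizes [:: 0; 1; 2] T
  | TL_ => [&& matching_tableau T, planar_tableau T & row1_sizes [:: 0; 2] T]
  | M_  =>
      [&& matching_tableau T, planar_tableau T & row1_sizes [:: 0; 1; 2] T]
  | PR_ => [&& matching_tableau T, planar_tableau T & row1_sizes [:: 0; 1] T]
  end.

Definition SMTA (A : algebra_family) (lam : seq nat) (k : nat) (T : tableau) : bool :=
  SMT lam k T && tableau_in A T.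

(** * The map phi *)

Fixpoint row_insert (x : {fset nat}) (T : tableau) : tableau :=
  match T with
  | [::] => [:: [:: x]]
  | row :: T' =>
      let i := find (set_lt x) row in
      if i < size row
      then set_nth fset0 row i x :: row_insert (nth fset0 row i) T'
      else rcons row x :: T'
  end.

(* Rows are numbered from 1. *)
Definition row_insert_from (r : nat) (x : {fset nat}) (T : tableau) : tableau :=
  take r.-1 T ++ row_insert x (drop r.-1 T).

Definition entry_with (k : nat) (T : tableau) : {fset nat} :=
  head fset0 [seq X : {fset nat} <- flatten T | k \in X].

(* A row that becomes empty disappears. *)
Definition delete_cell_with (k : nat) (T : tableau) : tableau :=
  [seq row <- [seq [seq X : {fset nat} <- row | k \notin X] | row <- T]
  | row != [::]].

Definition add_blank (T : tableau) : tableau :=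
  (fset0 :: row1 T) :: behead T.

Definition phi (k : nat) (T : tableau) : tableau * seq nat :=
  let A := entry_with k T in
  let T' := delete_cell_with k T in
  ((if A != [fset k]%fset then row_insert_from 2 (A `\ k)%fset T'
    else add_blank T'),
   shape T').

Definition number_of (P : tableau -> Prop) (m : nat) : Prop :=
  exists2 F : {fset tableau}, (forall T, T \in F <-> P T) & #|` F| = m.

(** * Index sets and branching rules *)

Definition irr_index (A : algebra_family) (k : nat) (nu : seq nat) : bool :=
  is_part nu &&
  match A with
  | P_ | R_ | RB_ => sumn nu <= k
  | CS_ => sumn nu == k
  | B_ => (sumn nu <= k) && ~~ odd (k - sumn nu)
  | TL_ => [&& size nu <= 1, sumn nu <= k & ~~ odd (k - sumn nu)]
  | M_ | PR_ | PP_ => (size nu <= 1) && (sumn nu <= k)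
  end.

(* The partitions obtained from nu by removing one cell, without repetition:
   a cell can be removed from row i exactly when row i+1 is shorter. *)
Definition remove_cell (nu : seq nat) : seq (seq nat) :=
  [seq [seq x <- set_nth 0 nu i (nth 0 nu i).-1 | 0 < x]
  | i <- iota 0 (size nu) & nth 0 nu i.+1 < nth 0 nu i].

Definition branching (A : algebra_family) (nu' nu : seq nat) : nat :=
  match A with
  | P_ | PP_ =>
      count (fun rho => (nu' == rho) || (rho \in remove_cell nu'))
            (nu :: remove_cell nu)
  | CS_ => nu' \in remove_cell nu
  | B_ | TL_ => (nu' \in remove_cell nu) || (nu \in remove_cell nu')
  | R_ | PR_ => (nu' == nu) || (nu' \in remove_cell nu)
  | RB_ | M_ =>
      [|| nu' == nu, nu' \in remove_cell nu | nu \in remove_cell nu']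
  end.

(* Edges from nu' at level k-1 to nu at level k, from the branching rules. *)
Definition rule_edges (A : algebra_family) (k : nat) (nu' nu : seq nat) : nat :=
  if irr_index A k.-1 nu' && irr_index A k nu then branching A nu' nu else 0.

(** * Diagram algebras *)

(* inl i is the vertex i+1 of the top row, inr i the vertex below it. *)
Notation vertex k := ('I_k + 'I_k)%type.
Notation diagram k := {set {set vertex k}}.

Definition blocks_le2 (k : nat) (d : diagram k) : bool :=
  [forall B in d, #|B| <= 2].

Definition blocks_eq2 (k : nat) (d : diagram k) : bool :=
  [forall B in d, #|B| == 2].

Definition pairs_transversal (k : nat) (d : diagram k) : bool :=
  [forall B in d, (#|B| == 2) ==>
     [exists i : 'I_k, inl i \in B] && [exists i : 'I_k, inr i \in B]].

(* Position of a vertex along the boundary of the rectangle: the top row from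
   left to right, then the bottom row from right to left.  A diagram can be
   drawn in the rectangle without crossings exactly when no two of its blocks
   interleave in this cyclic order. *)
Definition boundary_pos (k : nat) (v : vertex k) : nat :=
  match v with inl i => i | inr i => k.*2.-1 - i end.

Definition planar_diagram (k : nat) (d : diagram k) : bool :=
  [forall B1 in d, forall B2 in d, (B1 != B2) ==>
    ~~ [exists a in B1, exists b in B1, exists c in B2, exists e in B2,
         [&& boundary_pos a < boundary_pos c, boundary_pos c < boundary_pos b
           & boundary_pos b < boundary_pos e]]].

Definition diagram_in (A : algebra_family) (k : nat) (d : diagram k) : bool :=
  partition d [set: vertex k] &&
  match A with
  | P_  => true
  | CS_ => blocks_eq2 d && pairs_transversal d
  | B_  => blocks_eq2 d
  | R_  => blocks_le2 d && pairs_transversal d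
  | RB_ => blocks_le2 d
  | TL_ => blocks_eq2 d && planar_diagram d
  | M_  => blocks_le2 d && planar_diagram d
  | PR_ => [&& blocks_le2 d, pairs_transversal d & planar_diagram d]
  | PP_ => planar_diagram d
  end.

(* To multiply d1 and d2, d1 is stacked on top of d2; the vertices of the
   stack are ((top + middle) + bottom). *)
Notation stack_vertex k := (('I_k + 'I_k) + 'I_k)%type.

Definition upper (k : nat) (v : vertex k) : stack_vertex k := inl v.
Definition lower (k : nat) (v : vertex k) : stack_vertex k :=
  match v with inl i => inl (inr i) | inr i => inr i end.
Definition outer (k : nat) (v : vertex k) : stack_vertex k :=
  match v with inl i => inl (inl i) | inr i => inr i end.
Definition middle (k : nat) : {set stack_vertex k} :=
  [set inl (inr i) | i : 'I_k].

Definition stack_rel (k : nat) (d1 d2 : diagram k) : rel (stack_vertex k) :=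
  fun x y =>
    [exists B in d1, (x \in @upper k @: B) && (y \in @upper k @: B)] ||
    [exists B in d2, (x \in @lower k @: B) && (y \in @lower k @: B)].

Definition diagram_mul (k : nat) (d1 d2 : diagram k) : diagram k :=
  equivalence_partition
    (fun x y => connect (stack_rel d1 d2) (outer x) (outer y)) [set: vertex k].

(* Number of components of the stack lying entirely in the middle row. *)
Definition inner_components (k : nat) (d1 d2 : diagram k) : nat :=
  #|[set C in equivalence_partition (connect (stack_rel d1 d2))
                [set: stack_vertex k] | C \subset middle k]|.

Definition diagram_one (k : nat) : diagram k :=
  [set [set inl i; inr i] | i : 'I_k].

(* The inclusion of A_j in A_k adds vertical edges on the right. *)
Definition diagram_incl (j k : nat) (jk : j <= k) (d : diagram j) : diagram k :=
  let w (v : vertex j) : vertex k :=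
    match v with
    | inl i => inl (widen_ord jk i)
    | inr i => inr (widen_ord jk i)
    end in
  [set w @: (B : {set vertex j}) | B in d] :|: [set [set inl i; inr i] | i : 'I_k & j <= i].

(** * Representations and Bratteli diagrams *)

Local Open Scope ring_scope.

(* A matrix representation of A_k(n) is given by its values on the basis of
   diagrams in A; the values elsewhere are irrelevant.  Representations act on
   row vectors, as in mxrepresentation.v. *)
Record diagram_rep (C : numClosedFieldType) (k : nat) := DiagramRep {
  rep_dim : nat;
  rep_mx :> diagram k -> 'M[C]_rep_dim
}.

Section Representations.

Variables (C : numClosedFieldType) (A : algebra_family) (n : nat).

Definition is_rep (k : nat) (rho : diagram_rep C k) : Prop :=
  rho (diagram_one k) = 1%:M /\
  (forall d1 d2, diagram_in A d1 -> diagram_in A d2 ->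
     rho d1 *m rho d2 =
       (n%:R ^+ inner_components d1 d2) *: rho (diagram_mul d1 d2)).

Definition rep_hom (k : nat) (rho sigma : diagram_rep C k)
    (f : 'M[C]_(rep_dim rho, rep_dim sigma)) : Prop :=
  forall d, diagram_in A d -> rho d *m f = f *m sigma d.

Definition rep_iso (k : nat) (rho sigma : diagram_rep C k) : Prop :=
  exists f : 'M[C]_(rep_dim rho, rep_dim sigma),
    [/\ rep_hom f, row_free f & row_full f].

Definition is_irr (k : nat) (rho : diagram_rep C k) : Prop :=
  [/\ is_rep rho, (0 < rep_dim rho)%N
    & forall U : 'M[C]_(rep_dim rho),
        (forall d, diagram_in A d -> stablemx U (rho d)) ->
        U = 0 \/ row_full U].

Definition restrict (j k : nat) (jk : (j <= k)%N) (rho : diagram_rep C k) :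
    diagram_rep C j :=
  DiagramRep (fun d => rho (diagram_incl jk d)).

(* sigma is the direct sum of irreducible subrepresentations, the images of
   injective homomorphisms f i from tau i, of which exactly m are isomorphic
   to rho. *)
Definition multiplicity (k : nat) (rho sigma : diagram_rep C k) (m : nat) :
    Prop :=
  exists (r : nat) (tau : 'I_r -> diagram_rep C k)
         (f : forall i, 'M[C]_(rep_dim (tau i), rep_dim sigma))
         (J : {set 'I_r}),
  [/\ forall i, [/\ is_irr (tau i), rep_hom (f i) & row_free (f i)],
      row_full (\sum_i <<f i>>)%MS && mxdirect (\sum_i <<f i>>),
      forall i, i \in J <-> rep_iso rho (tau i)
    & #|J| = m].

(* A labelling V of representations indexes the irreducibles of A_k. *)
Definition irr_labelling (k : nat)
    (V : forall j, seq nat -> diagram_rep C j) : Prop :=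
  [/\ forall nu, irr_index A k nu -> is_irr (V k nu),
      forall nu nu', irr_index A k nu -> irr_index A k nu' ->
        rep_iso (V k nu) (V k nu') -> nu = nu'
    & forall rho : diagram_rep C k, is_irr rho ->
        exists2 nu, irr_index A k nu & rep_iso rho (V k nu)].

(* The number of edges from nu' at level k-1 to nu at level k is m. *)
Definition bratteli_edges (V : forall j, seq nat -> diagram_rep C j)
    (k : nat) (nu' nu : seq nat) (m : nat) : Prop :=
  if irr_index A k.-1 nu' && irr_index A k nu
  then multiplicity (V k.-1 nu') (restrict (leq_pred k) (V k nu)) m
  else m = 0%N.

(* V labels the irreducibles at levels k-1 and k in the standard way, i.e. in
   such a way that the known branching rules hold. *)
Definition standard_labelling (V : forall j, seq nat -> diagram_rep C j)
    (k : nat) : Prop :=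
  [/\ irr_labelling k.-1 V, irr_labelling k V
    & forall nu' nu, irr_index A k.-1 nu' -> irr_index A k nu ->
        bratteli_edges V k nu' nu (branching A nu' nu)].

End Representations.

(* Main.v *)
From mathcomp Require Import all_boot all_order all_algebra.
From mathcomp Require Import zify.
Require Import Defs.

(** The fibers of [phi] are counted by constructing its inverse, which is
    determined by the choice of one partition [rho].

    Disjoint nonempty subsets of {1, ..., k} number at most [k].  As
    [2 * k <= n], a tableau with these letters has at least [k] blank cells, all
    in its first row, and at most [k] cells below the first row.  Strictness of
    the columns between the first two rows is then automatic, and a standard
    multiset tableau amounts to a sorted first row and, independently of it, a
    standard tableau with nonempty entries ([SMT_intro], [SMT_elim]).

    Let [X = k |` B] be the entry of [T] that contains [k].  It is the largest
    entry, so [T] can be recovered from its shape [lam] and from what is left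
    when [X] is deleted: the first row [r], the lower rows [U] and the set [B]
    ([core_of_SMT], [SMT_attach_max]).  On the other side, the lower rows of
    [phi k T] are obtained by row insertion of [B] into [U], or are [U] itself
    if [B] is empty.  Row insertion can be undone once the cell that it has
    added is known ([row_insert_inj], [row_insert_surj]); so [S] and
    [rho = shape U] determine [r], [U] and [B], and [rho] can be [behead mu] or
    any partition obtained from it by removing a cell ([core_of_phi_image],
    [core_inj]).  Since [rho] is also [behead lam] or [behead lam] less a cell,
    the fiber for the partition algebra is indexed by the partitions [rho] that
    its branching rule counts.

    For the other families one has to know for which [rho] the tableau [T] lies
    in the family when [S] does.  The conditions on sizes of entries depend only
    on whether [B] is empty, that is [rho = behead mu], and on whether the
    deleted cell was in the first row, that is [rho = behead lam]
    ([sizes_in_core]).  Planarity holds for [T] exactly when it holds for [S],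
    provided [lam] has at most two rows ([planar_core]): the letter [k] exceeds
    all others, so that a letter of the second row avoids being between [X] only
    by preceding all of [B], and a set crosses [X] exactly when a letter of
    [B] is between it.  Selecting the admissible [rho] turns the rule for the
    partition algebra into the other branching rules ([branchingE]).  A standard
    labelling satisfies the branching rules by definition, which gives the
    statement on Bratteli diagrams. *)

Set Implicit Arguments.
Unset Strict Implicit.
Unset Printing Implicit Defensive.

(** * Removing a cell from a partition *)

Lemma is_part_cons (m : nat) (nu : seq nat) :
  is_part (m :: nu) = [&& 0 < m, nth 0 nu 0 <= m & is_part nu].
Proof.
rewrite /is_part inE negb_or eq_sym -lt0n.
case: nu => [|m' nu] /=; first by rewrite andbT.
by rewrite /geq /=; case: (m' <= m); case: (0 < m); rewrite /= ?andbF.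
Qed.

Lemma part_filter_id (nu : seq nat) : is_part nu -> [seq x <- nu | 0 < x] = nu.
Proof.
case/andP=> _ nu0; apply/all_filterP/allP=> x xnu.
by rewrite lt0n; apply: contraNneq nu0 => <-.
Qed.

Lemma is_part_behead (nu : seq nat) : is_part nu -> is_part (behead nu).
Proof. by case: nu => [|m nu] //; rewrite is_part_cons => /and3P[]. Qed.

(** A corner is either the end of the first row or a corner of the remaining
    rows.  This recursion replaces positions of cells in all inductions on
    shapes below. *)
Lemma remove_cell_cons (m : nat) (nu : seq nat) :
  is_part (m :: nu) ->
  remove_cell (m :: nu) =
    (if nth 0 nu 0 < m then [:: [seq x <- m.-1 :: nu | 0 < x]] else [::])
    ++ [seq m :: rho | rho <- remove_cell nu].
Proof.
rewrite is_part_cons => /and3P[m0 _ pnu].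
rewrite /remove_cell /= (iotaDl 1 0) filter_map.
have E s : [seq [seq x <- set_nth 0 (m :: nu) i (nth 0 (m :: nu) i).-1 | 0 < x]
              | i <- map (addn 1) s]
  = [seq m :: rho | rho <-
      [seq [seq x <- set_nth 0 nu i (nth 0 nu i).-1 | 0 < x] | i <- s]].
  by rewrite -!map_comp; apply: eq_map => i /=; rewrite m0.
by case: ifP => _ /=; rewrite E.
Qed.

Lemma remove_cellP (m : nat) (nu rho : seq nat) :
  is_part (m :: nu) ->
  reflect (nth 0 nu 0 < m /\ rho = [seq x <- m.-1 :: nu | 0 < x] \/
           exists2 rho', rho' \in remove_cell nu & rho = m :: rho')
          (rho \in remove_cell (m :: nu)).
Proof.
move=> pm; rewrite remove_cell_cons // mem_cat.
apply: (iffP orP) => -[].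
- by case: ifP => // lt; rewrite inE => /eqP->; left.
- by case/mapP=> rho' ? ->; right; exists rho'.
- by case=> lt ->; rewrite lt inE; left.
- by case=> rho' ? ->; right; apply/mapP; exists rho'.
Qed.

Lemma sumn_filter_pos (s : seq nat) : sumn [seq x <- s | 0 < x] = sumn s.
Proof. by elim: s => //= -[|x] s /= ->. Qed.

Lemma sumn_remove_cell (nu rho : seq nat) :
  is_part nu -> rho \in remove_cell nu -> sumn nu = (sumn rho).+1.
Proof.
elim: nu rho => // m nu IH rho pm /(remove_cellP _ pm) [[lt ->]|[r rin ->]].
  by rewrite sumn_filter_pos /= -addSn prednK // (leq_ltn_trans _ lt).
by move: pm; rewrite is_part_cons => /and3P[_ _ pnu] /=;
  rewrite (IH r) // addnS.
Qed.

Lemma remove_cell_irrefl (nu : seq nat) :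
  is_part nu -> nu \notin remove_cell nu.
Proof. by move=> pnu; apply/negP => /(sumn_remove_cell pnu) /n_Sn. Qed.

Lemma remove_cell_uniq (nu : seq nat) : is_part nu -> uniq (remove_cell nu).
Proof.
elim: nu => // m nu IH pm; rewrite remove_cell_cons //.
move: pm; rewrite is_part_cons => /and3P[m0 _ pnu].
rewrite cat_uniq map_inj_uniq ?IH //; last by move=> x y [].
rewrite andbT; apply/andP; split; first by case: ifP.
apply/hasPn => _ /mapP[rho _ ->]; case: ifP => // lt.
rewrite inE /= (part_filter_id pnu); case: ifP => _.
  by apply/eqP => -[E _]; move: m0; rewrite E; lia.
by apply/eqP => E; move: lt; rewrite -E ltnn.
Qed.

Lemma size_remove_cell (nu rho : seq nat) :
  is_part nu -> rho \in remove_cell nu -> size rho <= size nu.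
Proof.
elim: nu rho => // m nu IH rho pm /(remove_cellP _ pm) [[lt ->]|[r rin ->]].
  by rewrite (leq_trans (size_subseq (filter_subseq _ _))).
by move: pm; rewrite is_part_cons => /and3P[_ _ pnu] /=; rewrite ltnS IH.
Qed.

(** * Row insertion as a bijection *)

Lemma set_lt_trans : transitive set_lt.
Proof. by move=> Y X Z; apply: ltn_trans. Qed.

Definition count_le (t : nat) (r : seq {fset nat}) : nat :=
  count (fun X => max_letter X <= t) r.
Arguments count_le : simpl never.

(** For sorted rows with pairwise distinct largest letters, this says that the
    columns increase strictly from [r] to [s] and that [s] is not longer than
    [r].  Stated with counts, it can be followed through a row insertion without
    keeping track of positions. *)
Definition dominates (r s : seq {fset nat}) : Prop :=
  forall t, count_le t s <= count_le t r.

Fixpoint standard (W : tableau) : Prop :=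
  if W is r :: W' then
    [/\ sorted set_lt r, r != [::], dominates r (row1 W') & standard W']
  else True.

Definition keys (W : tableau) : seq nat := [seq max_letter X | X <- flatten W].

Lemma count_le_cat t r s : count_le t (r ++ s) = count_le t r + count_le t s.
Proof. exact: count_cat. Qed.

Lemma count_le_cons t X s :
  count_le t (X :: s) = (max_letter X <= t) + count_le t s.
Proof. by []. Qed.

Lemma count_le_rcons t X s :
  count_le t (rcons s X) = count_le t s + (max_letter X <= t).
Proof. by rewrite -cats1 count_le_cat /count_le /= addn0. Qed.

Lemma count_le_size t r : count_le t r <= size r.
Proof. exact: count_size. Qed.

Lemma count_le_mono t t' r : t <= t' -> count_le t r <= count_le t' r.
Proof. by move=> le; apply: sub_count => X /= /leq_trans; apply. Qed.

Lemma count_le_lt t Y r :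
  Y \in r -> t < max_letter Y -> count_le t r < count_le (max_letter Y) r.
Proof.
elim: r => // Z r IH; rewrite inE !count_le_cons => /predU1P[<-|Yr] lt.
  rewrite leqnn [_ <= t]leqNgt lt add0n add1n ltnS.
  by apply: count_le_mono; apply: ltnW.
rewrite -addnS leq_add ?IH //.
by case: (leqP _ t) => // le; rewrite (leq_trans le) // ltnW.
Qed.

Lemma count_le_all t r : all (fun X =>
  max_letter X <= t) r -> count_le t r = size r.
Proof. by rewrite all_count => /eqP. Qed.

Lemma count_le_none t r : all (fun X => t < max_letter X) r -> count_le t r = 0.
Proof.
move=> h; apply/eqP; rewrite -leqn0 leqNgt -has_count -all_predC.
by apply: sub_all h => X /=; rewrite -ltnNge.
Qed.

Lemma dominates_size r s : dominates r s -> size s <= size r.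
Proof.
move=> dom; pose t := \max_(X <- s) max_letter X.
rewrite -(@count_le_all t s);
  first exact: leq_trans (dom t) (count_le_size _ _).
by apply/allP => X Xs; rewrite /t (big_rem X) //= leq_maxl.
Qed.

Lemma standard_part W : standard W -> is_part (shape W).
Proof.
elim: W => // r W IH /= [_ r0 dom std]; rewrite is_part_cons IH // andbT.
rewrite lt0n size_eq0 r0 /=.
by case: W dom {IH std} => //= s W /dominates_size.
Qed.

Lemma sorted_catE (r s : seq {fset nat}) :
  sorted set_lt (r ++ s) =
  [&& sorted set_lt r, sorted set_lt s & allrel set_lt r s].
Proof.
by rewrite !(sorted_pairwise set_lt_trans) pairwise_cat
  [RHS]andbA [RHS]andbC.
Qed.

Lemma sorted_consE X (r : seq {fset nat}) :
  sorted set_lt (X :: r) = all (set_lt X) r && sorted set_lt r.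
Proof. by rewrite !(sorted_pairwise set_lt_trans). Qed.

Lemma row_insert_append x r W :
  all (fun Y => ~~ set_lt x Y) r -> row_insert x (r :: W) = rcons r x :: W.
Proof. by rewrite all_predC /= has_find => /negbTE->. Qed.

Lemma row_insert_bump x y r1 r2 W :
  all (fun Y => ~~ set_lt x Y) r1 -> set_lt x y ->
  row_insert x ((r1 ++ y :: r2) :: W) = (r1 ++ x :: r2) :: row_insert y W.
Proof.
move=> h xy /=; have E : find (set_lt x) (r1 ++ y :: r2) = size r1.
  by rewrite find_cat (negbTE (_ : ~~ has _ r1)) -?all_predC //= xy addn0.
rewrite E size_cat /= -ltn_subLR // subnn ltn0Sn nth_cat ltnn subnn /=.
congr (_ :: _); rewrite set_nthE size_cat /= addnS ltnS leq_addr.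
by rewrite take_size_cat // -(cat_rcons y) drop_size_cat ?size_rcons.
Qed.

Variant insert_spec x W : seq {fset nat} -> tableau -> Prop :=
| InsertAppend r & all (fun Y =>
  ~~ set_lt x Y) r : insert_spec x W r (rcons r x :: W)
| InsertBump r1 y r2 & all (fun Y => ~~ set_lt x Y) r1 & set_lt x y :
    insert_spec x W (r1 ++ y :: r2) ((r1 ++ x :: r2) :: row_insert y W).

Lemma row_insertP x r W : insert_spec x W r (row_insert x (r :: W)).
Proof.
case: (boolP (has (set_lt x) r)) => [|nh]; last first.
  rewrite -all_predC in nh.
  by rewrite row_insert_append //; apply: InsertAppend.
move=> h; have lt := h; rewrite has_find in lt.
have nf : all (fun Y => ~~ set_lt x Y) (take (find (set_lt x) r) r).
  by rewrite all_predC has_take_leq ?find_size // ltnn.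
have xy := nth_find fset0 h.
by rewrite -(cat_take_drop (find (set_lt x) r) r) (drop_nth fset0 lt)
  row_insert_bump //; apply: InsertBump.
Qed.

Lemma perm_flatten_row_insert x W :
  perm_eq (flatten (row_insert x W)) (x :: flatten W).
Proof.
elim: W x => [|r W IH] x //; case: row_insertP => [{}r _|r1 y r2 _ _];
  apply/permP => p.
  by rewrite /= -cats1 !count_cat /=; lia.
by have /permP/(_ p) := IH y; rewrite /= !count_cat /= ; lia.
Qed.

Lemma mem_row1_row_insert x W : x \in row1 (row_insert x W).
Proof.
case: W => [|r W]; first by rewrite inE.
case: row_insertP => [{}r _|r1 y r2 _ _] /=;
  first by rewrite mem_rcons inE eqxx.
by rewrite mem_cat inE eqxx orbT.
Qed.

Lemma count_le_row_insert_ge x W t :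
  count_le t (row1 W) <= count_le t (row1 (row_insert x W)).
Proof.
case: W => // r W; case: row_insertP => [{}r _|r1 y r2 _ xy] /=.
  by rewrite count_le_rcons leq_addr.
rewrite !count_le_cat !count_le_cons leq_add2l leq_add2r.
by case: (leqP (max_letter y) t) => // /(leq_trans (ltnW xy)) ->.
Qed.

Lemma count_le_row_insert_lt x W t :
  t < max_letter x -> count_le t (row1 (row_insert x W)) = count_le t (row1 W).
Proof.
move=> lt; have nx : (max_letter x <= t) = false by rewrite leqNgt lt.
case: W => [|r W]; first by rewrite /= /count_le /= nx.
case: row_insertP => [{}r _|r1 y r2 _ xy] /=;
  first by rewrite count_le_rcons nx addn0.
by rewrite !count_le_cat !count_le_cons nx leqNgt (ltn_trans lt xy).
Qed.

Lemma fresh_lt x r :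
  max_letter x \notin [seq max_letter Y | Y <- r] ->
  all (fun Y => ~~ set_lt x Y) r -> all (set_lt^~ x) r.
Proof.
move=> fr /allP h; apply/allP => Y Yr; rewrite /set_lt ltn_neqAle leqNgt.
rewrite (h Y Yr) andbT.
by apply: contraNneq fr => <-; apply: map_f.
Qed.

(** Only thresholds [t] from [y] up to the entry, if any, that [y] bumps out of
    the lower row need care.  Up to them the lower row has, besides [y], only
    entries smaller than [y]; they are at most as many as the entries of the
    upper row smaller than [y], and [y] itself, or [x] after the insertion, is
    one more entry of the upper row. *)
Lemma dominates_bump x y r1 r2 W :
  sorted set_lt (r1 ++ y :: r2) -> set_lt x y ->
  dominates (r1 ++ y :: r2) (row1 W) -> standard W ->
  max_letter y \notin keys W ->
  dominates (r1 ++ x :: r2) (row1 (row_insert y W)).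
Proof.
move=> sr xy dom std fr t.
case: (ltnP t (max_letter y)) => [lt|le].
  rewrite count_le_row_insert_lt //; apply: leq_trans (dom t) _.
  rewrite !count_le_cat !count_le_cons [max_letter y <= t]leqNgt lt.
  by rewrite leq_add2l leq_addl.
have -> : count_le t (r1 ++ x :: r2) = count_le t (r1 ++ y :: r2).
  by rewrite !count_le_cat !count_le_cons le (leq_trans (ltnW xy) le).
case: W dom std fr => [|s W] dom std fr.
  by rewrite /count_le /= le addn0 -has_count; apply/hasP; exists y;
     rewrite ?mem_cat ?mem_head ?orbT.
have frs : max_letter y \notin [seq max_letter Y | Y <- s].
  by apply: contra fr; rewrite /keys /= map_cat mem_cat => ->.
(* entries of the lower row smaller than y, compared with the upper row *)
have below s1 s2 : s = s1 ++ s2 -> all (fun Y => ~~ set_lt y Y) s1 ->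
    size s1 < count_le t (r1 ++ y :: r2).
  move=> Es nlt; have y0 : 0 < max_letter y by apply: leq_ltn_trans xy.
  have /allP lty : all (set_lt^~ y) s1.
    by apply: fresh_lt nlt; apply: contra frs; rewrite Es map_cat mem_cat => ->.
  have <- : count_le (max_letter y).-1 s1 = size s1.
    by apply: count_le_all; apply/allP => X /lty; rewrite /set_lt; lia.
  apply: leq_ltn_trans (leq_addr (count_le (max_letter y).-1 s2) _) _.
  rewrite -count_le_cat -Es; apply: leq_ltn_trans (dom _) _.
  apply: leq_trans (count_le_mono _ le); apply: count_le_lt; last by lia.
  by rewrite mem_cat mem_head orbT.
case: std => srt _ _ _; clear frs fr.
case: row_insertP below dom srt => [{}s h|s1 z s2 h yz] below dom srt /=.
  rewrite count_le_rcons le addn1; apply: leq_trans (below s [::] _ h);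
    last by rewrite cats0.
  by rewrite ltnS count_le_size.
have := dom t; rewrite /= !(count_le_cat t s1) !count_le_cons.
case: (leqP (max_letter z) t) => [le'|lt _]; first by rewrite le.
have lt2 : all (fun X => t < max_letter X) s2.
  move: srt; rewrite sorted_catE sorted_consE => /and3P[_ /andP[/allP h2 _] _].
  by apply/allP => X /h2; apply: ltn_trans.
rewrite le (count_le_none lt2) addn0 addn1.
by apply: leq_trans (below s1 (z :: s2) _ h); rewrite // ltnS count_le_size.
Qed.

Lemma sorted_bump x y r1 r2 :
  all (set_lt^~ x) r1 -> set_lt x y ->
  sorted set_lt (r1 ++ y :: r2) -> sorted set_lt (r1 ++ x :: r2).
Proof.
move=> h1 xy; rewrite !sorted_catE !sorted_consE !allrel_consr h1 /=.
case/and4P=> -> /andP[h2 ->] _ ->; rewrite !andbT.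
by apply: sub_all h2 => X; apply: ltn_trans.
Qed.

Lemma sorted_rcons_lt x r :
  all (set_lt^~ x) r -> sorted set_lt r -> sorted set_lt (rcons r x).
Proof. by move=> h s; rewrite -cats1 sorted_catE s allrel_consr h allrel0r. Qed.

Lemma standard_row_insert x W :
  standard W -> max_letter x \notin keys W -> uniq (keys W) ->
  standard (row_insert x W).
Proof.
elim: W x => [|r W IH] x; first by split.
case=> srt r0 dom std fr un.
have frr : max_letter x \notin [seq max_letter Y | Y <- r].
  by apply: contra fr; rewrite /keys /= map_cat mem_cat => ->.
move: un fr.
case: row_insertP frr srt r0 dom => [{}r h|r1 y r2 h xy] frr srt r0 dom un fr.
  split=> //; first exact: sorted_rcons_lt (fresh_lt frr h) srt.
    by rewrite -size_eq0 size_rcons.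
  by move=> t; apply: leq_trans (dom t) _; rewrite count_le_rcons leq_addr.
have h1 : all (set_lt^~ x) r1.
  by apply: fresh_lt h; apply: contra frr; rewrite map_cat mem_cat => ->.
move: un; rewrite /keys /= map_cat cat_uniq => /and3P[_ /hasPn yW unW].
have fry : max_letter y \notin keys W.
  apply/negP => /yW; rewrite map_cat mem_cat /= inE eqxx.
  by rewrite orbT.
split; first exact: sorted_bump h1 xy srt.
- by rewrite -size_eq0 size_cat /= addnS.
- exact: dominates_bump.
- exact: IH.
Qed.

Lemma shape_row_insert x W :
  standard W -> standard (row_insert x W) ->
  shape W \in remove_cell (shape (row_insert x W)).
Proof.
elim: W x => [|r W IH] x // [_ r0 dom std] std'.
have := standard_part std'; move: r0 dom std'.
case: row_insertP => [{}r _|r1 y r2 _ _] r0 dom std' pp;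
  apply/remove_cellP => //.
  left; rewrite size_rcons; split.
    by case: W dom {IH std std' pp} => // s W /dominates_size.
  rewrite /= lt0n size_eq0 r0 part_filter_id //.
  by move: pp; rewrite /= is_part_cons => /and3P[].
right; exists (shape W); last by rewrite /= !size_cat.
by apply: IH => //; case: std'.
Qed.

(** Insertion is undone from the bottom row upwards: once the entry [y] that was
    bumped out of the first row is known, its position in that row is found by
    counting the entries smaller than [y], and [x] is the entry now standing
    there. *)
Lemma row_insert_inj x x' U U' :
  standard U -> standard U' -> shape U = shape U' ->
  row_insert x U = row_insert x' U' -> x = x' /\ U = U'.
Proof.
elim: U x x' U' => [|r U IH] x x' [|r' U'] // ; first by move=> _ _ _ [].
move=> [srt _ _ std] [srt' _ _ std'] [szr szU].
case: row_insertP szr srt => [{}r _|r1 y r2 _ xy] szr srt;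
  case: row_insertP szr srt' => [{}r' _|r1' y' r2' _ xy'] szr srt'.
- by case=> /rcons_inj[-> ->] ->.
- by case=> /(congr1 size); move: szr; rewrite size_rcons !size_cat /= => ->;
    lia.
- by case=> /(congr1 size); move: szr; rewrite size_rcons !size_cat /= => <-;
    lia.
case=> er eU; case: (IH _ _ _ std std' szU eU) => ey eUU;
  rewrite -ey -eUU in srt' xy' *.
have cy q1 q2 z : sorted set_lt (q1 ++ y :: q2) -> set_lt z y ->
    count (set_lt^~ y) (q1 ++ z :: q2) = (size q1).+1.
  rewrite sorted_catE sorted_consE allrel_consr =>
    /and4P[_ /andP[h2 _] h1 _] zy; rewrite count_cat /=.
  have /eqP -> : count (set_lt^~ y) q2 == 0.
    rewrite -leqn0 leqNgt -has_count.
    by apply/hasPn => X /(allP h2); rewrite /set_lt -leqNgt => /ltnW.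
  by move: h1; rewrite all_count addn0 => /eqP ->; rewrite zy addn1.
have sz : size r1 = size r1'.
  by apply: succn_inj; rewrite -(cy r1 r2 x) // er cy.
by move/eqP: er; rewrite eqseq_cat // => /andP[/eqP-> /eqP[-> ->]].
Qed.

(** Reverse bumping: the entry [y] expelled by the lower rows takes the place of
    the largest entry smaller than [y] in the row above.  There is one, because
    [y] stands in the top row of the lower part, which the row above
    dominates. *)
Lemma row_insert_surj V rho :
  standard V -> uniq (keys V) -> rho \in remove_cell (shape V) ->
  exists x U, [/\ standard U, shape U = rho & row_insert x U = V].
Proof.
elim: V rho => // r V IH rho /[dup] std [srt r0 dom stdV] un.
have pp := standard_part std;
  case/(remove_cellP _ pp) => [[lt ->]|[rho' rin ->]].
  case/lastP: r srt r0 dom lt {std un pp} => // r x srt _ dom.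
  rewrite size_rcons ltnS => lt.
  have pV := standard_part stdV.
  have nx : all (fun Y => ~~ set_lt x Y) r.
    move: srt; rewrite -cats1 sorted_catE allrel_consr => /and4P[_ _ h _].
    by apply: sub_all h => Y; rewrite /set_lt -leqNgt => /ltnW.
  case: (posnP (size r)) => [/size0nil r0|r0].
    case: V {IH} stdV dom lt pV => [|s V] // stdV dom lt pV.
      by exists x, [::]; split=> //; rewrite r0.
    by move: pV lt; rewrite r0 [shape _]/= is_part_cons /= => /and3P[s0 _ _];
      lia.
  exists x, (r :: V); split; last 1 first.
  - exact: row_insert_append.
  - split=> //; first by move: srt; rewrite -cats1 sorted_catE => /and3P[].
      by rewrite -size_eq0 -lt0n.
    move=> t; have := dom t; rewrite count_le_rcons.
    case: (leqP (max_letter x) t) => [le _|_]; last by rewrite addn0.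
    rewrite [X in _ <= X]count_le_all.
      apply: leq_trans (count_le_size _ _) _.
      by case: V lt {IH dom stdV pV}.
    apply: sub_all nx => Y; rewrite /set_lt -leqNgt => /leq_trans; exact.
  - by rewrite /= r0 part_filter_id.
move: un; rewrite /keys /= map_cat cat_uniq => /and3P[unr /hasPn disj unV].
have [y [U [stdU shU eV]]] := IH _ stdV unV rin.
have yV : y \in row1 V by rewrite -eV mem_row1_row_insert.
have fry : max_letter y \notin [seq max_letter Y | Y <- r].
  apply: disj; apply: map_f;
    case: V yV {IH std dom stdV pp unV rin eV} => // s V ys.
  by rewrite /= mem_cat ys.
have hasle : has (fun Y => max_letter Y <= max_letter y) r.
  rewrite has_count; apply: leq_trans (dom _).
  by rewrite -has_count; apply/hasP; exists y.
(* r is cut at the place of y; the entry x to expel ends the first part *)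
pose i := find (set_lt y) r.
have Ei := cat_take_drop i r.
have nlt : all (fun Y => ~~ set_lt y Y) (take i r).
  by rewrite all_predC has_take_leq ?find_size // ltnn.
have lty := fresh_lt _ nlt.
have {}lty : all (set_lt^~ y) (take i r).
  by apply: lty; apply: contra fry; rewrite -{2}Ei map_cat mem_cat => ->.
have dropy : all (set_lt y) (drop i r).
  case: (ltnP i (size r)) => [lt|ge]; last by rewrite drop_oversize.
  have yi : set_lt y (nth fset0 r i) by apply: nth_find; rewrite has_find.
  have := srt; rewrite -{1}Ei sorted_catE (drop_nth fset0 lt) sorted_consE /=
    yi.
  case/and3P=> _ /andP[h _] _; apply: sub_all h => Y; exact: ltn_trans.
move: Ei lty dropy nlt; move: (take i r) (drop i r) => q r2 Er lty dropy nlt.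
case/lastP: q Er lty nlt => [|r1 x] Er.
  move=> _ _; have /hasP[Y] := hasle; rewrite -Er => /(allP dropy).
  by rewrite /set_lt ltnNge => /negP.
rewrite !all_rcons => /andP[xy lt1] /andP[_ nlt1].
have {}Er : r = r1 ++ x :: r2 by rewrite -Er cat_rcons.
rewrite Er in srt r0 dom.
exists x, ((r1 ++ y :: r2) :: U); split.
- split=> //.
  + move: srt; rewrite !sorted_catE !sorted_consE !allrel_consr lt1 dropy /=.
    by case/and4P=> -> /andP[_ ->] _ ->.
  + by rewrite -size_eq0 size_cat addnS.
  move=> t; case: (ltnP t (max_letter x)) => [ltx|lex].
    have -> : count_le t (r1 ++ y :: r2) = count_le t (r1 ++ x :: r2).
      by rewrite !count_le_cat !count_le_cons ![_ <= t]leqNgt ltx (ltn_trans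
        ltx xy).
    by apply: leq_trans (dom t); rewrite -eV count_le_row_insert_ge.
  case: (leqP (max_letter y) t) => [ley|lty].
    have -> : count_le t (r1 ++ y :: r2) = count_le t (r1 ++ x :: r2).
      by rewrite !count_le_cat !count_le_cons lex ley.
    by apply: leq_trans (dom t); rewrite -eV count_le_row_insert_ge.
  rewrite -(@count_le_row_insert_lt y) // eV -ltnS.
  apply: leq_trans (count_le_lt yV lty) _; apply: leq_trans (dom _) _.
  rewrite !count_le_cat !count_le_cons (ltnW xy :
    _ <= _) (@count_le_none _ r2) //.
  rewrite !addn0 addn1 ltnS; apply: leq_trans (count_le_size _ _) _.
  rewrite (@count_le_all t r1) ?leq_addr //; move: srt.
  rewrite sorted_catE allrel_consr => /and4P[_ _ h _].
  by apply: sub_all h => Y /ltnW /leq_trans; apply.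
- by rewrite /= shU Er !size_cat.
- rewrite row_insert_bump ?eV ?Er //.
  move: srt; rewrite sorted_catE allrel_consr => /and4P[_ _ h _].
  by apply: sub_all h => Y; rewrite /set_lt -leqNgt => /ltnW.
Qed.

(** * Adding and deleting a largest entry *)

(** If [shape U] is [nu] less one cell, then [X] is put into that cell. *)
Fixpoint place (X : {fset nat}) (U : tableau) (nu : seq nat) : tableau :=
  if U is r :: U' then
    if size r < nth 0 nu 0 then rcons r X :: U' else r :: place X U' (behead nu)
  else [:: [:: X]].

Lemma standard_nil W : standard W -> [::] \notin W.
Proof. by elim: W => //= r W IH [_ r0 _ /IH W0];
  rewrite inE negb_or eq_sym r0. Qed.

Lemma delete_cell_id k W :
  [::] \notin W -> all (fun Y : {fset nat} => k \notin Y) (flatten W) ->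
  delete_cell_with k W = W.
Proof.
elim: W => // r W IH; rewrite inE negb_or eq_sym /= all_cat => /andP[r0 W0].
case/andP=> /all_filterP kr kW; rewrite /delete_cell_with /= kr r0.
by congr cons; apply: IH.
Qed.

Lemma delete_place k X U nu :
  [::] \notin U -> all (fun Y : {fset nat} =>
    k \notin Y) (flatten U) -> k \in X ->
  delete_cell_with k (place X U nu) = U.
Proof.
move=> U0 kU kX; elim: U nu U0 kU => [|r U IH] nu.
  by rewrite /delete_cell_with /= kX.
move=> rU0 krU; have := delete_cell_id rU0 krU; move: rU0 krU.
rewrite inE negb_or eq_sym /= all_cat => /andP[r0 U0] /andP[kr kU].
rewrite /delete_cell_with /= (all_filterP kr) r0 => -[E].
case: ifP => _; last by rewrite /= (all_filterP kr) r0; congr cons; apply: IH.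
by rewrite /= filter_rcons kX /= (all_filterP kr) r0 E.
Qed.

Lemma perm_flatten_place X U nu :
  perm_eq (flatten (place X U nu)) (X :: flatten U).
Proof.
elim: U nu => [|r U IH] nu //=; case: ifP => _; apply/permP => p.
  by rewrite /= -cats1 !count_cat /=; lia.
by have /permP/(_ p) := IH (behead nu); rewrite /= !count_cat /= => ->; lia.
Qed.

Lemma shape_place X U nu :
  is_part nu -> shape U \in remove_cell nu -> shape (place X U nu) = nu.
Proof.
elim: nu U => // m nu IH U pm /(remove_cellP _ pm) [[lt shU]|[rho rin shU]].
  move: pm; rewrite is_part_cons => /and3P[m0 _ pnu].
  move: shU; rewrite /= part_filter_id //; case: ifP => [m1|m1]; last first.
    have E : m = 1 by lia.
    case: nu pnu lt {IH} => [|x nu];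
      last by rewrite E is_part_cons /= => /and3P[]; lia.
    by rewrite E; case: U.
  by case: U => //= r U [szr shU];
    rewrite szr prednK // leqnn /= size_rcons szr shU prednK.
move: pm; rewrite is_part_cons => /and3P[m0 _ pnu].
by case: U shU => //= r U [szr shU]; rewrite szr ltnn /= IH ?shU ?szr.
Qed.

Lemma size_row1_shape W : size (row1 W) = nth 0 (shape W) 0.
Proof. by case: W. Qed.

Lemma standard_place X U nu :
  is_part nu -> shape U \in remove_cell nu -> standard U ->
  all (set_lt^~ X) (flatten U) -> standard (place X U nu).
Proof.
move=> pnu shU; have := shape_place X pnu shU.
elim: U nu pnu shU => [|r U IH] nu pnu shU; first by move=> _ _ _; split.
move=> shp [srt r0 dom std]; rewrite /= all_cat => /andP[lr lU].
move: shp => /=; case: ifP => [_ _|nlt shp].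
  split=> //; first exact: sorted_rcons_lt.
    by rewrite -size_eq0 size_rcons.
  by move=> t; rewrite count_le_rcons (leq_trans (dom t)) ?leq_addr.
case: nu pnu shU nlt shp =>
  // m nu pm /(remove_cellP _ pm) /= shU nlt [szr shp].
move: pm; rewrite is_part_cons => /and3P[m0 le pnu].
have {}shU : shape U \in remove_cell nu.
  case: shU => [[lt]|[rho rin [_ ->]] //]; rewrite (part_filter_id pnu).
  by case: ifP => _; [case | case: nu lt {IH le shp pnu} =>
    // x nu /= lt [E _]]; lia.
split=> //; last exact: IH.
move=> t; case: (leqP (max_letter X) t) => [Xt|tX].
  rewrite (@count_le_all _ r); last first.
    by apply: sub_all lr => Y /ltnW /leq_trans; apply.
  by apply: leq_trans (count_le_size _ _) _; rewrite size_row1_shape shp szr.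
apply: leq_trans (dom t); case: U {IH lU shU shp std dom} => [|s U] /=.
  by rewrite count_le_cons [_ <= t]leqNgt tX.
by case: ifP => _ //; rewrite count_le_rcons [_ <= t]leqNgt tX addn0.
Qed.

Definition occ (k : nat) (s : seq {fset nat}) : nat :=
  count (fun Y : {fset nat} => k \in Y) s.
Arguments occ : simpl never.

Lemma occ_cat k r s : occ k (r ++ s) = occ k r + occ k s.
Proof. exact: count_cat. Qed.

Lemma occ_cons k X s : occ k (X :: s) = (k \in X) + occ k s.
Proof. by []. Qed.

Lemma occ_gt0 k (X : {fset nat}) (s : seq {fset nat}) :
  X \in s -> k \in X -> 0 < occ k s.
Proof. by move=> Xs kX; rewrite -has_count; apply/hasP; exists X. Qed.

Lemma all_notinE (k : nat) (s : seq {fset nat}) :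
  all (fun Y : {fset nat} => k \notin Y) s =
  (occ k s == 0).
Proof. by elim: s => //= Y s ->; rewrite occ_cons; case: (k \in Y). Qed.

(** A largest entry ends its row, and it stands in a corner: the next row, whose
    entries are all smaller than [X], is no longer than the part of the row of
    [X] that is smaller than [X].  The last conclusion serves the induction,
    where it keeps the row above in order. *)
Lemma delete_standard k X W :
  standard W -> X \in flatten W -> k \in X ->
  occ k (flatten W) = 1 ->
  (forall Y, Y \in flatten W -> k \notin Y -> set_lt Y X) ->
  let U := delete_cell_with k W in
  [/\ standard U, shape U \in remove_cell (shape W), place X U (shape W) = W
    & dominates (row1 W) (row1 U)].
Proof.
move=> std XW kX cW lt U.
rewrite {}/U; elim: W std XW cW lt => // r W IH std;
  have pp := standard_part std.
case: std => srt r0 dom std.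
rewrite /= mem_cat occ_cat => /orP[Xr|XW] cW lt.
  have cr : 0 < occ k r.
    by apply: occ_gt0 kX.
  have kW : all (fun Y : {fset nat} => k \notin Y) (flatten W).
    by rewrite all_notinE; lia.
  have {}cr : occ k r = 1 by move: kW; rewrite all_notinE; lia.
  case/splitPr: Xr srt r0 cr dom lt pp => r1 r2 srt r0.
  rewrite occ_cat occ_cons kX => cr dom lt pp.
  have k1 : all (fun Y : {fset nat} => k \notin Y) r1.
    by rewrite all_notinE; lia.
  have k2 : all (fun Y : {fset nat} => k \notin Y) r2.
    by rewrite all_notinE; lia.
  have r20 : r2 = [::].
    case: r2 srt k2 lt {r0 cr dom pp} => // Y r2.
    rewrite sorted_catE sorted_consE =>
      /and3P[_ /andP[/andP[XY _] _] _] /andP[kY _] lt.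
    have := lt Y _ kY; rewrite !mem_cat !inE eqxx !orbT => /(_ isT).
    by move: XY; rewrite /set_lt; lia.
  rewrite {}r20 cats1 {k2 r2 cr} in srt r0 dom lt pp *.
  have lr1 : all (set_lt^~ X) r1.
    apply/allP => Y Y1; apply: lt; last exact: (allP k1).
    by rewrite mem_cat mem_rcons inE Y1 orbT.
  have lW : all (set_lt^~ X) (flatten W).
    apply/allP => Y Y1; apply: lt; last exact: (allP kW).
    by rewrite mem_cat Y1 orbT.
  have dom' : dominates r1 (row1 W).
    move=> t; case: (leqP (max_letter X) t) => [Xt|tX]; last first.
      by have := dom t; rewrite count_le_rcons [_ <= t]leqNgt tX addn0.
    rewrite (@count_le_all _ r1); last first.
      by apply: sub_all lr1 => Y /ltnW /leq_trans; apply.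
    have lW1 : all (set_lt^~ X) (row1 W).
      by case: (W) lW => // s W'; rewrite /= all_cat => /andP[].
    apply: leq_trans (count_le_size _ _) _;
      have [X0|X0] := posnP (max_letter X).
      by case: (row1 W) lW1 => // Y s /andP[]; rewrite /set_lt X0.
    have <- : count_le (max_letter X).-1 (row1 W) = size (row1 W).
      by apply: count_le_all; apply: sub_all lW1 => Y; rewrite /set_lt; lia.
    apply: leq_trans (dom _) _;
      rewrite count_le_rcons [max_letter X <= _]leqNgt.
    by rewrite ltn_predL X0 addn0 count_le_size.
  have W0 := standard_nil std.
  have EU : delete_cell_with k (rcons r1 X :: W) =
      if r1 != [::] then r1 :: W else W.
    rewrite /delete_cell_with /= filter_rcons kX /= (all_filterP k1).
    have EW := delete_cell_id W0 kW; rewrite /delete_cell_with in EW.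
    by case: ifP => _; rewrite EW.
  rewrite EU; case: eqP => [r10|/eqP r10] /=.
    have W1 : W = [::].
      by case: W dom' std {IH kW W0 EU lW lt dom pp cW} => // s W;
        rewrite r10 => /dominates_size;
         rewrite leqn0 size_eq0 /row1 /= => /eqP -> [].
    split=> //; rewrite W1 r10 //=.
  split=> //.
  - by split=> //; move: srt; rewrite -cats1 sorted_catE => /and3P[].
  - apply/remove_cellP => //; left; rewrite size_rcons; split.
      by rewrite ltnS -size_row1_shape; apply: dominates_size dom'.
    by rewrite /= lt0n size_eq0 r10 part_filter_id //; apply: standard_part.
  - by rewrite size_rcons leqnn.
  - by move=> t; rewrite count_le_rcons leq_addr.
have nr : all (fun Y : {fset nat} => k \notin Y) r.
  rewrite all_notinE.
  have : 0 < occ k (flatten W).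
    by apply: occ_gt0 kX.
  lia.
have {}cW : occ k (flatten W) = 1.
  by move: cW nr; rewrite all_notinE; lia.
have [|stdU shU plU domU] := IH std XW cW.
  by move=> Y YW; apply: lt; rewrite mem_cat YW orbT.
have -> : delete_cell_with k (r :: W) = r :: delete_cell_with k W.
  by rewrite /delete_cell_with /= (all_filterP nr) r0.
split=> //.
- by split=> // t; apply: leq_trans (domU t) (dom t).
- by apply/remove_cellP => //; right; exists (shape (delete_cell_with k W)).
- by rewrite /= ltnn plU.
Qed.

(** * Letters and blank cells *)

Lemma max_letter0 : max_letter fset0 = 0.
Proof. by rewrite /max_letter big_nil. Qed.

Lemma max_letter_ge (c : nat) (X : {fset nat}) : c \in X -> c <= max_letter X.
Proof. by move=> cX; apply: (@leq_bigmax_seq _ (enum_fset X) xpredT id). Qed.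

Lemma max_letter_mem (X : {fset nat}) : X != fset0 -> max_letter X \in X.
Proof.
case/fset0Pn => c cX; rewrite /max_letter.
have mx a s : \max_(b <- a :: s) b \in a :: s.
  elim: s a => [|b s IH] a; first by rewrite big_cons big_nil maxn0 mem_head.
  rewrite big_cons /maxn; case: ltnP => _; last exact: mem_head.
  by rewrite inE IH orbT.
have {}cX : c \in enum_fset X by [].
by change (\max_(b <- X) b \in enum_fset X);
  case: (enum_fset X) cX => // a s _; apply: mx.
Qed.

(** The content condition in a form that is invariant under permutation of the
    entries and can be added up over parts of a tableau. *)
Definition letters (k : nat) (s : seq {fset nat}) : Prop :=
  forall c, occ c s = (0 < c <= k).

Lemma contentP k T : reflect (letters k (flatten T)) (content k T).
Proof.
apply: (iffP andP) => [[/allP rng /allP one] c|lt].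
  have [ck|nck] := boolP (0 < c <= k).
    by apply/eqP; apply: (one c); rewrite mem_iota add1n ltnS.
  apply/eqP; rewrite -all_notinE; apply/allP => X XT.
  by apply: contra nck => cX; have /allP := rng X XT; apply.
split; apply/allP.
  move=> X XT; apply/allP => c cX; have := occ_gt0 XT cX; rewrite lt;
    by case: (0 < c <= k).
by move=> c; rewrite mem_iota add1n ltnS => ck; have := lt c;
  rewrite ck /occ => ->.
Qed.

Lemma letters_perm k r s : perm_eq r s -> letters k r -> letters k s.
Proof. by move=> /permP p lt c; rewrite -lt /occ p. Qed.

Lemma sum_mem_occ c (s : seq {fset nat}) : \sum_(X <- s) (c \in X :
  nat) = occ c s.
Proof. by rewrite /occ -sum1_count [RHS]big_mkcond; apply: eq_bigr => X _;
  case: ifP. Qed.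

Lemma sum_card_letters k (s : seq {fset nat}) :
  letters k s -> \sum_(X <- s) #|` X| = k.
Proof.
move=> lt; have E X : X \in s -> #|` X| = \sum_(c <- iota 1 k) (c \in X : nat).
  move=> Xs; have /perm_size -> :
    perm_eq (enum_fset X) [seq c <- iota 1 k | c \in X].
    apply: uniq_perm; rewrite ?filter_uniq ?iota_uniq ?fset_uniq // => c.
    rewrite mem_filter -[c \in enum_fset X]/(c \in X);
      case cX: (c \in X) => //=.
    by have := occ_gt0 Xs cX; rewrite lt mem_iota add1n ltnS;
      case: (0 < c <= k).
  by rewrite size_filter -sum1_count big_mkcond; apply: eq_bigr => c _;
    case: ifP.
rewrite big_seq (eq_bigr _ E) -big_seq exchange_big /=.
rewrite (eq_big_seq (fun=> 1)); first by rewrite sum1_size size_iota.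
by move=> c; rewrite mem_iota add1n ltnS sum_mem_occ lt => ->.
Qed.

Definition blanks (s : seq {fset nat}) : nat := count (pred1 fset0) s.

(** Every nonblank entry uses up at least one of the [k] letters. *)
Lemma size_le_blanks k r s :
  letters k (r ++ s) -> fset0 \notin s ->
  size r + size s <= blanks r + k /\ size s <= k.
Proof.
move=> lt s0; have ge1 X : X != fset0 -> 1 <= #|` X| by rewrite cardfs_gt0.
have ler : size r <= blanks r + \sum_(X <- r) #|` X|.
  rewrite /blanks; elim: (r) => //= X q; rewrite big_cons.
  by case: eqVneq => [->|/ge1] /=; lia.
have les : size s <= \sum_(X <- s) #|` X|.
  elim: (s) s0 => //= X q IH; rewrite inE negb_or eq_sym big_cons.
  by case/andP=> /ge1 le /IH; rewrite -add1n; apply: leq_add.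
have := sum_card_letters lt; rewrite big_cat => <-; split;
  last exact: leq_trans les (leq_addl _ _).
by rewrite addnA leq_add.
Qed.

Lemma set_le_trans : transitive set_le.
Proof.
move=> Y X Z /predU1P[->|XY] // /predU1P[<-|YZ]; apply/predU1P; right => //.
exact: set_lt_trans YZ.
Qed.

Lemma sorted_set_le_rcons X r :
  all (set_lt^~ X) r -> sorted set_le r -> sorted set_le (rcons r X).
Proof.
move=> h s; rewrite (sorted_pairwise set_le_trans) pairwise_rcons.
rewrite -(sorted_pairwise set_le_trans) s andbT.
by apply: sub_all h => Y YX; rewrite /set_le YX orbT.
Qed.

(** Disjoint nonempty sets are compared strictly in last letter order. *)
Lemma uniq_keys (s : seq {fset nat}) :
  (forall c, occ c s <= 1) -> fset0 \notin s ->
    uniq [seq max_letter X | X <- s].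
Proof.
elim: s => //= X s IH le; rewrite inE negb_or eq_sym => /andP[X0 s0].
rewrite IH // ?andbT; last by move=> c; have := le c; rewrite occ_cons; lia.
apply/mapP => -[Y Ys E]; have := le (max_letter X);
  rewrite occ_cons max_letter_mem //.
have Y0 : Y != fset0 by apply: contraNneq s0 => <-.
by rewrite leqNgt add1n ltnS {1}E (occ_gt0 Ys) // max_letter_mem.
Qed.

Lemma positive_keys_nonempty s : all (fun X =>
  0 < max_letter X) s -> fset0 \notin s.
Proof. by apply: contraL => s0; apply/allPn; exists fset0;
  rewrite // max_letter0. Qed.

Lemma keys_gt0 k s X : letters k s -> X \in s -> X != fset0 -> 0 < max_letter X.
Proof.
move=> lt Xs /max_letter_mem mX; have := occ_gt0 Xs mX; rewrite lt.
by case: (0 < max_letter X).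
Qed.

Lemma letters_max k s X : letters k s -> X \in s -> max_letter X <= k.
Proof.
move=> lt Xs; have [->|/max_letter_mem mX] := eqVneq X fset0;
  first by rewrite max_letter0.
by have := occ_gt0 Xs mX; rewrite lt; lia.
Qed.

(** * Standard multiset tableaux *)

Lemma column_strict_dominates r s :
  size s <= size r -> column_strict r s -> dominates r s.
Proof.
move=> le cs t; elim: r s le cs => [|X r IH] [|Y s] //= le /andP[XY cs].
rewrite !count_le_cons leq_add ?IH //.
by case: (leqP (max_letter Y) t) => // /(leq_trans (ltnW XY)) ->.
Qed.

Lemma dominates_column_strict r s :
  sorted set_lt r -> sorted set_lt s -> dominates r s ->
  {in r & s, forall X Y, max_letter X != max_letter Y} -> column_strict r s.
Proof.
elim: r s => [|X r IH] [|Y s] //;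
  rewrite !sorted_consE => /andP[Xr sr] /andP[Ys ss] dom ne.
have XY : max_letter X < max_letter Y.
  rewrite ltn_neqAle ne ?mem_head // leqNgt; apply/negP => YX.
  have := dom (max_letter Y);
    rewrite !count_le_cons leqnn [max_letter X <= _]leqNgt YX.
  by rewrite (@count_le_none _ r) //; apply: sub_all Xr => Z; apply: ltn_trans.
rewrite /column_strict /=; apply/andP; split; first exact: XY.
apply: IH => // [t|Z Z' Zr Zs]; last by apply: ne; rewrite inE ?Zr ?Zs orbT.
have := dom t; rewrite !count_le_cons; case: (leqP (max_letter Y) t) => [Yt|tY].
  by rewrite (leq_trans (ltnW XY) Yt) leq_add2l.
by rewrite (@count_le_none _ s) //; apply: sub_all Ys => Z; apply: ltn_trans.
Qed.

Lemma column_strict_blank r s :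
  sorted set_le r -> size s <= blanks r ->
  all (fun X => 0 < max_letter X) s -> column_strict r s.
Proof.
rewrite /blanks; elim: r s => [|X r IH] [|Y s] // srt le /andP[Y0 s0].
rewrite /column_strict /=.
have E : X = fset0.
  apply: contraTeq le => X0; rewrite /= (negbTE X0) -ltnNge ltnS.
  rewrite (leq_trans (n := 0)) // leqNgt -has_count; apply/hasPn => Z Zr.
  move: srt; rewrite (sorted_pairwise set_le_trans) /= =>
    /andP[/allP/(_ Z Zr) + _].
  case/predU1P=> [<- //|]; apply: contraTneq => ->.
  by rewrite /set_lt max_letter0.
rewrite E /set_lt max_letter0 Y0 /=; apply: IH => //;
  first exact: path_sorted srt.
by move: le; rewrite E /= ?eqxx add1n ltnS.
Qed.

Lemma occ_letters k s : letters k s -> forall c, occ c s <= 1.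
Proof. by move=> lt c; rewrite lt leq_b1. Qed.

Lemma size_row1_flatten W : size (row1 W) <= size (flatten W).
Proof. by case: W => // r W; rewrite /= size_cat leq_addr. Qed.

Lemma standard_columns W :
  standard W -> uniq (keys W) -> sorted column_strict W.
Proof.
elim: W => // r [|s W] IH //= [srt _ dom std];
  rewrite /keys /= map_cat cat_uniq.
case/and3P=> _ /hasPn disj un; apply/andP; split; last by apply: IH.
apply: dominates_column_strict => //; first by case: std.
move=> X Y Xr Ys; apply: contraTneq (map_f max_letter Xr) => ->.
by apply: disj; apply: map_f; rewrite mem_cat Ys.
Qed.

Lemma sorted_set_lt s :
  sorted set_le s -> uniq [seq max_letter X | X <- s] -> sorted set_lt s.
Proof.
elim: s => // X [|Y s] IH //= /andP[XY srt] /andP[Xs un].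
apply/andP; split; last exact: IH.
by case/predU1P: XY Xs => // ->; rewrite mem_head.
Qed.

Lemma standard_of_columns W :
  is_part (shape W) -> all (sorted set_le) W -> sorted column_strict W ->
  uniq (keys W) -> standard W.
Proof.
elim: W => // r W IH /= pW /andP[sr sW] cW; rewrite /keys /= map_cat cat_uniq.
case/and3P=> unr _ unW; move: pW; rewrite is_part_cons => /and3P[r0 le pW].
split; [exact: sorted_set_lt | by rewrite -size_eq0 -lt0n | | ]; last first.
  by apply: IH => //; apply: path_sorted cW.
case: W cW le {IH sW unW pW} => [|s W] //= /andP[cs _] le.
exact: column_strict_dominates.
Qed.

Lemma columns_nonempty r W :
  is_part (shape (r :: W)) -> path column_strict r W ->
  all (fun X => 0 < max_letter X) (flatten W).
Proof.
elim: W r => // s W IH r;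
  rewrite /= is_part_cons => /and3P[_ le pW] /andP[cs cW].
rewrite all_cat (IH s) // andbT.
move: le cs; rewrite /=;
  elim: s r {IH cW pW} => [|Y s IH] [|X r] // le /andP[XY cs].
by rewrite /= (IH r) // andbT; apply: leq_ltn_trans XY.
Qed.

(** The blank cells of the first row reach at least as far as the second row, so
    that no condition relates the first row to the rows below it. *)
Lemma SMT_intro k n lam r W :
  part_of n lam -> 2 * k <= n -> shape (r :: W) = lam ->
  letters k (r ++ flatten W) -> sorted set_le r -> standard W ->
  fset0 \notin flatten W -> SMT lam k (r :: W).
Proof.
case/andP=> _ /eqP sn kn sh lt sr std W0; apply/and4P; split.
- by rewrite sh.
- by apply/contentP.
- rewrite /= sr; apply/allP => s sW;
    elim: W std sW {sh lt W0} => //= q W IH [sq _ _ /IH{}IH].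
  rewrite inE => /predU1P[->|//]; apply: sub_sorted sq => X Y XY.
  by rewrite /set_le XY orbT.
have E : size r + size (flatten W) = n
  by rewrite -sn -sh -size_flatten size_cat.
have un : uniq (keys W).
  apply: uniq_keys => // c; apply: leq_trans (occ_letters lt c).
  by rewrite occ_cat leq_addl.
have := standard_columns std un;
  case: W std W0 lt E {un sh} => // s W std W0 lt E /= ->.
rewrite andbT; have [b1 b2] := size_le_blanks lt W0.
apply: column_strict_blank => //.
  by have := size_row1_flatten (s :: W); rewrite -[row1 _]/s; lia.
apply/allP => X Xs; apply: (keys_gt0 lt);
  first by rewrite mem_cat /= mem_cat Xs orbT.
by apply: contraNneq W0 => <-; rewrite mem_cat Xs.
Qed.

Lemma SMT_elim k n lam T :
  part_of n lam -> 0 < n -> SMT lam k T ->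
  exists r W, [/\ T = r :: W, size r + size (flatten W) = n,
    letters k (r ++ flatten W), sorted set_le r & standard W /\ fset0 \notin
      flatten W].
Proof.
case/andP=> plam /eqP sn n0 /and4P[/eqP sh /contentP lt sT cT].
case: T sh lt sT cT => [|r W] sh lt; first by move: n0; rewrite -sn -sh.
move=> /andP[sr sW] cT; exists r, W.
have W0 : fset0 \notin flatten W.
  by apply/positive_keys_nonempty/(@columns_nonempty r) => //; rewrite sh.
split=> //; first by rewrite -sn -sh -size_flatten size_cat.
split=> //; apply: standard_of_columns => //.
- by move: plam; rewrite -sh; apply: is_part_behead.
- exact: path_sorted cT.
apply: uniq_keys => // c; apply: leq_trans (occ_letters lt c).
by rewrite occ_cat leq_addl.
Qed.

(** * Deleting the entry with the largest letter *)

(** The data left by a tableau of size [n] with letters 1, ..., [k] after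
    deletion of the entry [k |` B]: first row [r] and lower rows [U].  Nothing
    records where the deleted cell was. *)
Definition core k n r U B : Prop :=
  [/\ sorted set_le r, standard U, fset0 \notin flatten U,
      letters k.-1 (B :: r ++ flatten U) & (size r + size (flatten U)).+1 = n].

(** The tableau of shape [lam] that leaves the core [r], [U], [B]: the deleted
    cell was in the first row precisely when the lower rows are intact. *)
Definition attach_max (lam : seq nat) (k : nat) r U (B : {fset nat}) :
  tableau :=
  if shape U == behead lam then rcons r (k |` B)%fset :: U
  else r :: place (k |` B)%fset U (behead lam).

(** The tableau that [phi] produces from the core [r], [U], [B]. *)
Definition phi_tab r U (B : {fset nat}) : tableau :=
  if B == fset0 then (fset0 :: r) :: U else r :: row_insert B U.

Lemma sorted_blank r : sorted set_le r -> fset0 \in r -> r = fset0 :: behead r.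
Proof.
case: r => // X r; rewrite (sorted_pairwise set_le_trans) /= inE => /andP[h _].
case/predU1P=> [->//|/(allP h) /predU1P[->//|]].
by rewrite /set_lt max_letter0.
Qed.

(** In particular the first row does not disappear with the cell deleted from
    it. *)
Lemma core_blank k n r U B :
  0 < k -> 2 * k <= n -> core k n r U B -> fset0 \in r.
Proof.
move=> k0 kn [_ _ U0 lt sz].
have [] := @size_le_blanks k.-1 (B :: r) _ lt U0; rewrite /blanks /= => le _.
by rewrite -has_pred1 has_count; case: (B == fset0) le => /=; lia.
Qed.

Lemma letters_add k B s :
  0 < k -> letters k.-1 (B :: s) -> letters k ((k |` B)%fset :: s).
Proof.
move=> k0 lt c; have := lt c; rewrite !occ_cons in_fset1U.
have := lt k; rewrite occ_cons.
by case: eqVneq => [->|]; case: (_ \in B); lia.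
Qed.

Lemma max_letter_add k B s :
  0 < k -> letters k.-1 (B :: s) -> max_letter (k |` B)%fset = k.
Proof.
move=> k0 /(letters_add k0) lt; apply/eqP; rewrite eqn_leq.
by rewrite (letters_max lt) ?mem_head // max_letter_ge // fset1U1.
Qed.

Lemma entry_withE k (T : tableau) (X : {fset nat}) :
  X \in flatten T -> k \in X -> occ k (flatten T) = 1 -> entry_with k T = X.
Proof.
move=> XT kX o; rewrite /entry_with.
have : X \in filter (fun Y : {fset nat} => k \in Y) (flatten T).
  by rewrite mem_filter kX.
have : size (filter (fun Y : {fset nat} => k \in Y) (flatten T)) = 1.
  by rewrite size_filter.
by case: filter => // Y [|Z s] //= _; rewrite inE => /eqP.
Qed.

Lemma shape_of_behead n lam (T : tableau) :
  part_of n lam -> T != [::] -> 0 < n -> behead (shape T) = behead lam ->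
  size (flatten T) = n -> shape T = lam.
Proof.
case/andP=> _ /eqP <- {n}; case: lam T => [|m lam] [|r W] //= _ _ <-.
by rewrite size_cat size_flatten => /eqP; rewrite eqn_add2r => /eqP ->.
Qed.

Lemma delete_cell_cons k r W :
  [seq X : {fset nat} <- r | k \notin X] != [::] ->
  delete_cell_with k (r :: W) = [seq X :
    {fset nat} <- r | k \notin X] :: delete_cell_with k W.
Proof. by rewrite /delete_cell_with /= => ->. Qed.

Lemma perm_attach_max lam k r U B :
  perm_eq (flatten (attach_max lam k r U B)) ((k |` B)%fset :: r ++ flatten U).
Proof.
rewrite /attach_max; case: ifP => _; apply/permP => p /=.
  by rewrite -cats1 !count_cat /=; lia.
have /permP/(_ p) /= := perm_flatten_place (k |` B)%fset U (behead lam).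
by rewrite !count_cat => ->; lia.
Qed.

Lemma core_notin k n r U B :
  0 < k -> core k n r U B ->
  [/\ k \notin B, all (fun Y : {fset nat} => k \notin Y) r &
      all (fun Y : {fset nat} => k \notin Y) (flatten U)].
Proof.
move=> k0 [_ _ _ /(_ k) + _]; rewrite occ_cons occ_cat !all_notinE.
by case: (k \in B) => /= E; split=> //; lia.
Qed.

Lemma core_below k n r U B :
  0 < k -> core k n r U B -> all (set_lt^~ (k |` B)%fset) (r ++ flatten U).
Proof.
move=> k0 [_ _ _ lt _]; apply/allP => X XrU;
  rewrite /set_lt (max_letter_add k0 lt).
by have := letters_max lt (_ : X \in _); rewrite inE XrU orbT => /(_ isT); lia.
Qed.

Lemma SMT_attach_max k n lam r U B :
  0 < k -> 2 * k <= n -> part_of n lam -> core k n r U B ->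
  shape U \in behead lam :: remove_cell (behead lam) ->
  SMT lam k (attach_max lam k r U B).
Proof.
move=> k0 kn plam cr shU; have := core_below k0 cr;
  rewrite all_cat => /andP[br bU].
have perm := perm_attach_max lam k r U B.
case: cr => sr stdU U0 lt sz; have lt' := letters_add k0 lt.
have szT : size (flatten (attach_max lam k r U B)) = n.
  by rewrite (perm_size perm) /= size_cat.
have {}lt' : letters k (flatten (attach_max lam k r U B)).
  by apply: letters_perm lt'; rewrite perm_sym.
have X0 : (k |` B)%fset != fset0 by apply/fset0Pn; exists k; rewrite fset1U1.
have n0 : 0 < n by rewrite -sz.
have plam' : is_part (behead lam) by case/andP: plam => /is_part_behead.
move: szT lt' shU {perm}; rewrite /attach_max;
  case: ifP => [/eqP eU|nU] szT lt' shU.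
  apply: (SMT_intro plam kn) => //; first exact: (shape_of_behead plam).
  exact: sorted_set_le_rcons.
move: shU; rewrite inE nU /= => shU.
apply: (SMT_intro plam kn) => //.
- by apply: (shape_of_behead plam) => //=; apply: shape_place.
- exact: standard_place.
by rewrite (perm_mem (perm_flatten_place _ _ _)) inE negb_or eq_sym X0.
Qed.

Lemma phi_attach_max k n lam r U B :
  0 < k -> 2 * k <= n -> core k n r U B ->
  phi k (attach_max lam k r U B) = (phi_tab r U B, shape (r :: U)).
Proof.
move=> k0 kn cr; have [kB kr kU] := core_notin k0 cr.
have perm := perm_attach_max lam k r U B; have rb := core_blank k0 kn cr.
case: cr => sr stdU U0 lt sz; have lt' := letters_add k0 lt.
have kX : k \in (k |` B)%fset by rewrite fset1U1.
have r0 : r != [::] by apply: contraTneq rb => ->.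
have EX : entry_with k (attach_max lam k r U B) = (k |` B)%fset.
  apply: entry_withE => //; first by rewrite (perm_mem perm) mem_head.
  by rewrite /occ (permP perm) -[count _ _]/(occ _ _) lt' k0 leqnn.
have ED : delete_cell_with k (attach_max lam k r U B) = r :: U.
  have nU := standard_nil stdU.
  rewrite /attach_max; case: ifP => _;
    rewrite delete_cell_cons ?filter_rcons ?kX ?(all_filterP kr) //=.
    by rewrite delete_cell_id.
  by rewrite delete_place.
rewrite /phi EX ED /phi_tab fsetU1K // /row_insert_from /= take0 drop0.
have -> : ((k |` B)%fset != [fset k]%fset) = (B != fset0).
  congr (~~ _); apply/eqP/eqP => [E|->]; last by rewrite fsetU0.
  apply/eqP; rewrite -[B](fsetU1K kB) E; apply/eqP/fsetP => c.
  by rewrite !inE; case: eqP.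
by case: eqP.
Qed.

Lemma letters_remove k X s :
  k \in X -> letters k (X :: s) -> letters k.-1 ((X `\ k)%fset :: s).
Proof.
move=> kX lt c; have := lt c; rewrite !occ_cons in_fsetD1.
by have [->|ck] := eqVneq c k; rewrite ?kX /=; [|case: (c \in X)]; lia.
Qed.

(** The entry containing [k] is the largest one, hence the last of its row, and
    in the lower rows [delete_standard] applies to it. *)
Lemma core_of_SMT k n lam T :
  0 < k -> 2 * k <= n -> part_of n lam -> SMT lam k T ->
  exists r U B, [/\ core k n r U B, T = attach_max lam k r U B
    & shape U \in behead lam :: remove_cell (behead lam)].
Proof.
move=> k0 kn plam smt; have n0 : 0 < n by lia.
have [r [W [ET sz lt sr [stdW W0]]]] := SMT_elim plam n0 smt.
have shW : shape W = behead lam by case/and4P: smt => /eqP <- _ _ _; rewrite ET.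
have pW := standard_part stdW; rewrite {smt}ET.
have ok : occ k (r ++ flatten W) = 1 by rewrite lt k0 leqnn.
have /hasP[X XT kX] : has (fun Y : {fset nat} => k \in Y) (r ++ flatten W).
  by rewrite has_count -/(occ _ _) ok.
have EX : X = (k |` (X `\ k))%fset by rewrite fsetD1K.
have maxX : max_letter X = k.
  by apply/eqP; rewrite eqn_leq (letters_max lt) // max_letter_ge.
have ltX Y : Y \in r ++ flatten W -> k \notin Y -> set_lt Y X.
  move=> YT kY; rewrite /set_lt maxX ltn_neqAle (letters_max lt) // andbT.
  have [->|/max_letter_mem mY] := eqVneq Y fset0.
    by rewrite max_letter0 eq_sym -lt0n.
  by apply: contraNneq kY => <-.
move: XT; rewrite mem_cat => /orP[Xr|XW].
  case/lastP: r lt ok ltX sr sz Xr => // r Y lt ok ltX sr sz.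
  have EY : X \in rcons r Y -> X = Y.
    rewrite mem_rcons inE => /predU1P[//|Xr].
    move: sr; rewrite (sorted_pairwise set_le_trans) pairwise_rcons =>
      /andP[/allP/(_ X Xr) + _].
    case/predU1P => // XY.
    have := letters_max lt (_ : Y \in _);
      rewrite mem_cat mem_rcons mem_head => /(_ isT).
    by move: XY; rewrite /set_lt maxX; lia.
  move=> /EY {EY} EXY; rewrite -{Y}EXY in lt ok ltX sr sz *.
  have perm : perm_eq (rcons r X ++ flatten W) (X :: r ++ flatten W).
    by apply/permP => p; rewrite -cats1 !count_cat /= count_cat; lia.
  exists r, W, (X `\ k)%fset; split.
  - split=> //.
    + by move: sr; rewrite !(sorted_pairwise set_le_trans) pairwise_rcons =>
        /andP[].
    + by apply: letters_remove => //; apply: letters_perm lt.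
    + by move: sz; rewrite size_rcons.
  - by rewrite /attach_max shW eqxx -EX.
  - by rewrite shW mem_head.
have kr : occ k r = 0.
  by move: ok (occ_gt0 XW kX); rewrite occ_cat; lia.
have okW : occ k (flatten W) = 1 by move: ok; rewrite occ_cat kr.
have [|stdU shU plU _] := delete_standard stdW XW kX okW.
  by move=> Y YW; apply: ltX; rewrite mem_cat YW orbT.
have perm := perm_flatten_place X (delete_cell_with k W) (shape W).
rewrite plU in perm.
have perm' : perm_eq (r ++ flatten W) (X :: r ++ flatten (delete_cell_with k
  W)).
  apply/permP => p; have /permP/(_ p) /= := perm.
  by rewrite !count_cat => ->; lia.
exists r, (delete_cell_with k W), (X `\ k)%fset; split.
- split=> //.
  + apply: contra W0 => U0; rewrite (perm_mem perm) inE U0 orbT //.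
  + by apply: letters_remove => //; apply: letters_perm lt.
  + by rewrite -sz (perm_size perm) /= addnS.
- rewrite /attach_max -shW ifN -?EX ?plU //.
  by apply: contraTneq shU => ->; apply: remove_cell_irrefl.
- by rewrite -shW inE shU orbT.
Qed.

Lemma letters_insert_perm k r U B :
  letters k (B :: r ++ flatten U) -> letters k (r ++ flatten (row_insert B U)).
Proof.
apply: letters_perm; apply/permP => p.
have /permP/(_ p) /= := perm_flatten_row_insert B U.
by rewrite !count_cat => ->; lia.
Qed.

Lemma core_keys k n r U B :
  core k n r U B -> B != fset0 -> uniq (max_letter B :: keys U).
Proof.
case=> _ _ U0 lt _ B0; apply: (@uniq_keys (B :: flatten U)).
  move=> c; apply: leq_trans (occ_letters lt c).
  by rewrite !occ_cons occ_cat leq_add2l leq_addl.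
by rewrite inE negb_or eq_sym B0.
Qed.

Lemma SMT_phi_tab k n mu r U B :
  0 < k -> 2 * k <= n -> part_of n mu -> core k n r U B ->
  shape (phi_tab r U B) = mu ->
  SMT mu k.-1 (phi_tab r U B) /\
  (if B == fset0 then shape U = behead mu
   else shape U \in remove_cell (behead mu)).
Proof.
move=> k0 kn pmu cr; have ck := core_keys cr.
have rb := core_blank k0 kn cr.
case: cr => sr stdU U0 lt sz; have kn' : 2 * k.-1 <= n by lia.
rewrite /phi_tab; case: ifP => [/eqP B0|/negbT B0] sh.
  split; last by rewrite -sh.
  apply: (SMT_intro pmu kn') => //; first by rewrite -{1}B0.
  have E := sorted_blank sr rb; rewrite E in sr *.
  by rewrite /= in sr *; rewrite sr.
have /andP[fr un] := ck B0; have stdV := standard_row_insert stdU fr un.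
split; last by rewrite -sh; apply: shape_row_insert.
apply: (SMT_intro pmu kn') => //; first exact: letters_insert_perm.
by rewrite (perm_mem (perm_flatten_row_insert _ _)) inE negb_or eq_sym B0.
Qed.

Lemma core_of_phi_image k n mu S rho :
  0 < k -> 2 * k <= n -> part_of n mu -> SMT mu k.-1 S ->
  rho \in behead mu :: remove_cell (behead mu) ->
  exists r U B, [/\ core k n r U B, shape U = rho, S = phi_tab r U B
    & (B == fset0) = (rho == behead mu)].
Proof.
move=> k0 kn pmu smt; have n0 : 0 < n by lia.
have [r [W [ES sz lt sr [stdW W0]]]] := SMT_elim pmu n0 smt.
have shW : shape W = behead mu by case/and4P: smt => /eqP <- _ _ _; rewrite ES.
have pW := standard_part stdW; rewrite {smt}ES -{}shW inE.
case: eqP => [-> _|_ /= rin].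
  have rb : fset0 \in r.
    have [] := size_le_blanks lt W0; rewrite sz -has_pred1 has_count /blanks;
      lia.
  have E := sorted_blank sr rb; rewrite E in sr lt sz *.
  move: (behead r) sr lt sz => {rb E}r sr lt sz.
  exists r, W, fset0; split=> //.
  by split=> //; apply: path_sorted sr.
have unW : uniq (keys W).
  apply: uniq_keys => // c; apply: leq_trans (occ_letters lt c).
  by rewrite occ_cat leq_addl.
have [B [U [stdU shU EW]]] := row_insert_surj stdW unW rin.
have perm := perm_flatten_row_insert B U; rewrite EW in perm.
move: W0; rewrite (perm_mem perm) inE negb_or => /andP[B0 U0].
exists r, U, B; split=> //; last 2 first.
- by rewrite /phi_tab eq_sym (negbTE B0) EW.
- by rewrite eq_sym (negbTE B0).
split=> //; last by rewrite -sz (perm_size perm) /= addnS.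
apply: letters_perm lt; apply/permP => p; have /permP/(_ p) /= := perm.
by rewrite !count_cat => ->; lia.
Qed.

(** Insertion enlarges the shape, so [S] and [shape U] already tell whether [B]
    is empty. *)
Lemma core_inj k n r U B r' U' B' :
  core k n r U B -> core k n r' U' B' ->
  shape U = shape U' -> phi_tab r U B = phi_tab r' U' B' ->
  [/\ r = r', U = U' & B = B'].
Proof.
move=> cr cr'; have ck := core_keys cr; have ck' := core_keys cr'.
case: cr cr' => _ stdU _ _ _ [_ stdU' _ _ _] sh.
have grow W C : standard W -> C != fset0 -> uniq (max_letter C :: keys W) ->
    forall W', row_insert C W = W' -> shape W != shape W'.
  move=> stdW C0 /= /andP[fr un] _ <-;
    have stdV := standard_row_insert stdW fr un.
  apply: contraTneq (shape_row_insert stdW stdV) => ->.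
  exact/remove_cell_irrefl/standard_part.
rewrite /phi_tab; case: ifP => [/eqP B0|/negbT B0];
  case: ifP => [/eqP B0'|/negbT B0'].
- by rewrite B0 B0' => -[-> ->].
- by case=> _ /esym EU; have := grow _ _ stdU' B0' (ck' B0') _ EU;
    rewrite sh eqxx.
- by case=> _ EU; have := grow _ _ stdU B0 (ck B0) _ EU; rewrite sh eqxx.
by case=> -> /(row_insert_inj stdU stdU' sh) [-> ->].
Qed.

(** * Size conditions *)

Definition planar_family (A : algebra_family) : bool :=
  match A with TL_ | M_ | PR_ | PP_ => true | _ => false end.

(** [blank] stands for [B] being empty and [first] for the deleted cell being in
    the first row.  For Brauer algebras, for instance, an entry of
    size one must be below the first row and an entry of size two must be in
    it. *)
Definition allowed (A : algebra_family) (blank first : bool) : bool :=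
  match A with
  | P_ | PP_ => true
  | CS_ => blank && ~~ first
  | B_ | TL_ => blank != first
  | R_ | PR_ => blank
  | RB_ | M_ => blank || first
  end.

(** The conditions defining a family, except planarity. *)
Definition sizes_in (A : algebra_family) (T : tableau) : bool :=
  match A with
  | P_ | PP_ => true
  | CS_ => matching_tableau T && row1_sizes [:: 0] T
  | B_ | TL_ => matching_tableau T && row1_sizes [:: 0; 2] T
  | R_ | PR_ => matching_tableau T && row1_sizes [:: 0; 1] T
  | RB_ | M_ => matching_tableau T && row1_sizes [:: 0; 1; 2] T
  end.

Lemma tableau_inE A T :
  tableau_in A T = sizes_in A T && (planar_family A ==> planar_tableau T).
Proof.
by case: A; rewrite /= ?andbT //; case: matching_tableau; rewrite //= andbC.
Qed.

Lemma all_rows_flatten (p : pred {fset nat}) (W : tableau) :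
  all (all p) W = all p (flatten W).
Proof. by elim: W => //= r W ->; rewrite all_cat. Qed.

Lemma matching_attach_max lam k r U (B : {fset nat}) :
  k \notin B ->
  matching_tableau (attach_max lam k r U B) =
  [&& all (fun X : {fset nat} => #|` X| <= 2) r,
      all (fun X : {fset nat} => #|` X| == 1) (flatten U)
    & #|` B| <= (shape U == behead lam)].
Proof.
move=> kB; have cX : #|` (k |` B)%fset| = #|` B|.+1 by rewrite cardfsU1 kB.
rewrite /matching_tableau /attach_max all_rows_flatten; case: ifP => _ /=.
  by rewrite all_rcons cX ltnS -andbA andbC -andbA.
rewrite (perm_all _ (perm_flatten_place _ _ _)) /= cX eqSS leqn0.
by rewrite [_ && all _ _]andbC.
Qed.

Lemma matching_phi_tab r U (B : {fset nat}) :
  matching_tableau (phi_tab r U B) =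
  [&& all (fun X : {fset nat} => #|` X| <= 2) r,
      all (fun X : {fset nat} => #|` X| == 1) (flatten U)
    & #|` B| <= 1].
Proof.
rewrite /matching_tableau /phi_tab all_rows_flatten -cardfs_eq0;
  case: ifP => [/eqP->|B0] /=.
  by rewrite ?cardfs0 andbT.
rewrite (perm_all _ (perm_flatten_row_insert _ _)) /= [_ && all _ _]andbC.
by case: #|` B| B0 => [|[|b]] /=.
Qed.

Lemma row1_sizes_attach_max s lam k r U (B : {fset nat}) :
  k \notin B ->
  row1_sizes s (attach_max lam k r U B) =
  all (fun X : {fset nat} => #|` X| \in s) r &&
  ((shape U == behead lam) ==> (#|` B|.+1 \in s)).
Proof.
move=> kB; rewrite /row1_sizes /attach_max; case: ifP => _ /=;
  last by rewrite andbT.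
by rewrite all_rcons cardfsU1 kB andbC.
Qed.

Lemma row1_sizes_phi_tab s r U (B : {fset nat}) :
  0 \in s ->
  row1_sizes s (phi_tab r U B) = all (fun X : {fset nat} => #|` X| \in s) r.
Proof. by move=> s0; rewrite /row1_sizes /phi_tab; case: ifP => //= _;
  rewrite ?cardfs0 s0. Qed.

Lemma sizes_in_core A k lam r U (B : {fset nat}) :
  k \notin B ->
  sizes_in A (attach_max lam k r U B) =
  sizes_in A (phi_tab r U B) && allowed A (B == fset0) (shape U == behead lam).
Proof.
move=> kB; rewrite -cardfs_eq0; set loc := shape U == _.
case: A => //=; rewrite matching_attach_max // matching_phi_tab //
  row1_sizes_attach_max //;
  rewrite row1_sizes_phi_tab // -/loc; case: loc; case: #|` B| => [|[|b]] /=;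
  rewrite ?inE ?andbT ?andbF //=.
Qed.

(** * Planarity *)

Definition none_between (Y X : {fset nat}) :
  Prop := forall c, c \in Y -> ~~ between c X.

(** Planarity of the tableau with first row [r] and second row [u]. *)
Definition planar_rows (r u : seq {fset nat}) : Prop :=
  pairwise noncrossing r /\
  {in u & r ++ u, forall Y X, X != Y -> none_between Y X}.

Lemma planar_tableauP T :
  reflect (size T <= 2 /\ planar_rows (row1 T) (row2 T)) (planar_tableau T).
Proof.
have E : size T <= 2 -> flatten T = row1 T ++ row2 T.
  by case: T => [|r [|u [|]]] //= _; rewrite ?cats0.
apply: (iffP and3P) => [[sz nc /allP h]|[sz [nc h]]]; split=> //.
  split=> // Y X Yu; rewrite -E // => XT XY c cY.
  by have /allP/(_ c cY)/allP/(_ X XT) := h Y Yu; rewrite (negbTE XY).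
apply/allP => Y Yu; apply/allP => c cY; apply/allP => X; rewrite E // => XT.
by have [//|XY] /= := eqVneq X Y; apply: (h Y X).
Qed.

Lemma crossingP (X Y : {fset nat}) :
  reflect (exists a c b d, [/\ a \in X, c \in Y, b \in X & d \in Y] /\
             [/\ a < c, c < b & b < d]) (crossing X Y).
Proof.
apply: (iffP hasP) => [[a aX /hasP[c cY /hasP[b bX /hasP[d dY /and3P[ac cb
  bd]]]]]|].
  by exists a, c, b, d.
move=> [a [c [b [d [[aX cY bX dY] [ac cb bd]]]]]]; exists a => //.
apply/hasP; exists c => //; apply/hasP; exists b => //; apply/hasP;
  exists d => //.
by rewrite ac cb.
Qed.

Lemma betweenP c (X : {fset nat}) :
  reflect (exists a b, [/\ a \in X, b \in X & a < c < b]) (between c X).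
Proof.
apply: (iffP andP) => [[/hasP[a aX ac] /hasP[b bX cb]]|[a [b [aX bX /andP[ac
  cb]]]]].
  by exists a, b; rewrite ac.
by split; apply/hasP; [exists a | exists b].
Qed.

Lemma planar_rows_blank r u : planar_rows (fset0 :: r) u <-> planar_rows r u.
Proof.
have b0 Y : none_between Y fset0 by move=> c _; apply/betweenP => -[a [b []]].
have n0 X : noncrossing fset0 X.
  by apply/andP; split; apply/crossingP => -[a [c [b [d [[]]]]]].
split=> -[nc h]; split.
- by move: nc => /andP[].
- by move=> Y X Yu Xru; apply: h => //; rewrite inE Xru orbT.
- by apply/andP; split=> //; apply/allP => X _; apply: n0.
by move=> Y X Yu; rewrite inE => /predU1P[->|Xru] XY //; apply: h.
Qed.

Lemma planar_rows_rcons1 r u X :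
  X \notin u ->
  planar_rows (rcons r X) u <->
  [/\ planar_rows r u, {in r, forall Z, noncrossing Z X}
    & {in u, forall Y, none_between Y X}].
Proof.
move=> Xu; rewrite /planar_rows pairwise_rcons;
  split=> [[/andP[/allP n1 n2] h]|].
  split=> //; first split=> //.
    move=> Y Z Yu Zru; apply: h => //; move: Zru;
      rewrite !mem_cat mem_rcons inE.
    by case/orP=> ->; rewrite ?orbT.
  move=> Y Yu; apply: (h Y X) => //;
    first by rewrite mem_cat mem_rcons mem_head.
  by apply: contraNneq Xu => ->.
case=> -[nc h] n1 n2; split; first by rewrite nc andbT; apply/allP.
move=> Y Z Yu; rewrite mem_cat mem_rcons inE -orbA => /or3P[/eqP-> _|Zr|Zu] .
- exact: n2.
- by apply: h => //; rewrite mem_cat Zr.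
- by apply: h => //; rewrite mem_cat Zu orbT.
Qed.

Lemma planar_rows_rcons2 r u X :
  X \notin r -> X \notin u ->
  planar_rows r (rcons u X) <->
  [/\ planar_rows r u, {in r ++ u, forall Z, none_between X Z}
    & {in u, forall Y, none_between Y X}].
Proof.
move=> Xr Xu; have mu Z : Z \in r ++ rcons u X = (Z == X) || (Z \in r ++ u).
  by rewrite !mem_cat mem_rcons inE orbCA.
split=> [[nc h]|[[nc h] h1 h2]].
  split.
  - split=> // Y Z Yu Zru; apply: h; first by rewrite mem_rcons inE Yu orbT.
    by rewrite mu Zru orbT.
  - move=> Z Zru; apply: (h X Z); first by rewrite mem_rcons mem_head.
      by rewrite mu Zru orbT.
    by apply: contraTneq Zru => ->; rewrite mem_cat negb_or Xr.
  - move=> Y Yu; apply: (h Y X); first by rewrite mem_rcons inE Yu orbT.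
      by rewrite mu eqxx.
    by apply: contraNneq Xu => ->.
split=> // Y Z; rewrite mem_rcons inE mu => /predU1P[->|Yu] /predU1P[->|Zru] ne.
- by move: ne; rewrite eqxx.
- exact: h1.
- exact: h2.
- exact: h.
Qed.

Section TwoRows.
Variables (k : nat) (r u : seq {fset nat}) (B : {fset nat}).
Hypothesis below : {in B :: r ++ u, forall Z c, c \in Z -> c < k}.
Hypothesis disjointB : {in r ++ u, forall Z c, c \in B -> c \notin Z}.
Hypothesis u0 : fset0 \notin u.
Let X := (k |` B)%fset.

Lemma addk_notin Z : Z \in r ++ u -> X != Z.
Proof.
move=> Zru; apply: contraTneq (fset1U1 k B) => EX; apply/negP;
  rewrite -/X EX => kZ.
by have := below (_ : Z \in _) kZ; rewrite inE Zru orbT ltnn => /(_ isT).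
Qed.

Lemma addk_notin_rows : X \notin r /\ X \notin u.
Proof.
by split; apply/negP => Xin; have := @addk_notin X;
  rewrite mem_cat Xin ?orbT eqxx => /(_ isT).
Qed.

Lemma not_between_k Z : Z \in r ++ u -> ~~ between k Z.
Proof.
move=> Zru; apply/betweenP => -[a [b [_ bZ /andP[_ kb]]]].
by have := below (_ : Z \in _) bZ;
  rewrite inE Zru orbT ltnNge ltnW // => /(_ isT).
Qed.

(** The letter [k] is to the right of every letter, so a letter of [Y] is
    between [X] as soon as one letter of [B] precedes it. *)
Lemma none_between_addk Y : Y \in u ->
  none_between Y X <-> (forall a c, a \in B -> c \in Y -> ~~ (a < c)).
Proof.
move=> Yu; have ltk c : c \in Y -> c < k.
  by apply: below; rewrite inE mem_cat Yu !orbT.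
split=> [h a c aB cY|h c cY].
  apply: contra (h c cY) => ac; apply/betweenP; exists a, k.
  by rewrite /X !inE aB eqxx orbT ac ltk.
apply/betweenP => -[a [b [+ _ /andP[ac _]]]];
  rewrite /X !inE => /predU1P[ak|aB].
  by have := ltk c cY; rewrite -ak ltnNge ltnW.
by have := h a c aB cY; rewrite ac.
Qed.

(** This is why row insertion of [B] does not bump any entry out of the second
    row when [T] is planar. *)
Lemma none_between_addk_lt : B != fset0 ->
  {in u, forall Y, none_between Y X} -> all (set_lt^~ B) u.
Proof.
move=> B0 h; apply/allP => Y Yu;
  have Y0 : Y != fset0 by apply: contraNneq u0 => <-.
have := (none_between_addk Yu).1 (h Y Yu) _ _ (max_letter_mem B0)
  (max_letter_mem Y0).
rewrite -leqNgt leq_eqVlt => /predU1P[E|//].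
have := disjointB (_ : Y \in _) (max_letter_mem B0).
by rewrite mem_cat Yu orbT -E max_letter_mem // => /(_ isT).
Qed.

Lemma none_between_addkE : all (set_lt^~ B) u ->
  {in u, forall Y, none_between Y X} <-> {in u, forall Y, none_between Y B}.
Proof.
move/allP=> ltB; split=> h Y Yu.
  move=> c cY; apply: contra (h Y Yu c cY) => /betweenP[a [b [aB bB acb]]].
  by apply/betweenP; exists a, b; rewrite /X !inE aB bB !orbT.
apply/none_between_addk => // a c aB cY; apply: contra (h Y Yu c cY) => ac.
have B0 : B != fset0 by apply: contraTneq aB => ->.
apply/betweenP; exists a, (max_letter B); rewrite aB max_letter_mem // ac.
by split=> //; apply: leq_ltn_trans (ltB Y Yu); apply: max_letter_ge.
Qed.

(** The letter [k] can only come last in a crossing, so the inner letter that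
    belongs to [X] is in [B]; it is between two letters of [Z]. *)
Lemma noncrossing_addk : {in r ++ u, forall Z, none_between B Z} ->
  {in r, forall Z, noncrossing Z X}.
Proof.
move=> h Z Zr; have Zru : Z \in r ++ u by rewrite mem_cat Zr.
have ltk c : c \in Z -> c < k by apply: below; rewrite inE Zru orbT.
apply/andP; split; apply/crossingP =>
  -[a [c [b [d [[aZ cX bZ dX] [ac cb bd]]]]]].
  move: cX; rewrite /X !inE => /predU1P[ck|cB].
    by have := ltk b bZ; rewrite -ck ltnNge ltnW.
  by have /betweenP[] := h Z Zru c cB; exists a, b; rewrite ac.
move: bZ; rewrite /X !inE => /predU1P[bk|bB].
  by have := ltk d dX; rewrite -bk ltnNge ltnW.
by have /betweenP[] := h Z Zru b bB; exists c, d; rewrite cb.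
Qed.

(** If [Z] is in the first row, a letter of [B] between two letters of [Z]
    produces a crossing with [k] as its last letter; if [Z] is in the second
    row, the larger of the two letters is between [X]. *)
Lemma noncrossing_addk_none_between :
  {in r, forall Z, noncrossing Z X} -> {in u, forall Y, none_between Y X} ->
  {in r ++ u, forall Z, none_between B Z}.
Proof.
move=> h1 h2 Z; rewrite mem_cat => /orP[Zr|Zu] c cB;
  apply/betweenP => -[a [b [aZ bZ /andP[ac cb]]]].
  have /andP[/crossingP nc _] := h1 Z Zr; case: nc; exists a, c, b, k;
    rewrite /X !inE cB eqxx orbT.
  split=> //; split=> //; apply: below bZ; by rewrite inE mem_cat Zr orbT.
by have := (none_between_addk Zu).1 (h2 Z Zu) c b cB bZ; rewrite cb.
Qed.

Lemma addk_none_between :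
  {in r ++ u, forall Z, none_between X Z} <-> {in r ++ u, forall Z,
    none_between B Z}.
Proof.
split=> h Z Zru c cX; first by apply: h => //; rewrite /X !inE cX orbT.
by move: cX; rewrite /X !inE => /predU1P[->|]; [exact: not_between_k|exact: h].
Qed.

Lemma B_notin_rows : B != fset0 -> B \notin r /\ B \notin u.
Proof.
move=> B0; have h Z : Z \in r ++ u -> B != Z.
  move=> Zru; have := disjointB Zru (max_letter_mem B0).
  by apply: contraNneq => <-; apply: max_letter_mem.
by split; apply/negP => Bin; have := h B;
  rewrite mem_cat Bin ?orbT eqxx => /(_ isT).
Qed.

(** Attached to either row, [X] imposes the same conditions as [B] does at the
    end of the second row. *)
Lemma planar_rows_first : B != fset0 ->
  planar_rows (rcons r X) u <-> all (set_lt^~ B) u /\ planar_rows r (rcons u B).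
Proof.
move=> B0; have [Xr Xu] := addk_notin_rows; have [Br Bu] := B_notin_rows B0.
rewrite planar_rows_rcons1 // planar_rows_rcons2 //.
split=> [[p h1 h2]|[ltB [p h1 h2]]].
  have ltB := none_between_addk_lt B0 h2; split=> //.
  by split=> //; [exact: noncrossing_addk_none_between |
    apply/none_between_addkE].
by split=> //; [exact: noncrossing_addk | apply/none_between_addkE].
Qed.

Lemma planar_rows_second : B != fset0 ->
  planar_rows r (rcons u X) <-> all (set_lt^~ B) u /\ planar_rows r (rcons u B).
Proof.
move=> B0; have [Xr Xu] := addk_notin_rows; have [Br Bu] := B_notin_rows B0.
rewrite !planar_rows_rcons2 //.
split=> [[p h1 h2]|[ltB [p h1 h2]]].
  have ltB := none_between_addk_lt B0 h2; split=> //.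
  by split=> //; [apply/addk_none_between | apply/none_between_addkE].
by split=> //; [apply/addk_none_between | apply/none_between_addkE].
Qed.

Lemma planar_rows_first0 : B = fset0 ->
  planar_rows (rcons r X) u <-> planar_rows r u.
Proof.
move=> B0; have [Xr Xu] := addk_notin_rows; rewrite planar_rows_rcons1 //.
split=> [[]//|p]; split=> //.
  by apply: noncrossing_addk => Z _ c; rewrite B0.
by move=> Y Yu; apply/none_between_addk => // a c; rewrite B0.
Qed.

Lemma planar_rows_second0 : B = fset0 ->
  planar_rows r (rcons u X) <-> planar_rows r u.
Proof.
move=> B0; have [Xr Xu] := addk_notin_rows; rewrite planar_rows_rcons2 //.
split=> [[]//|p]; split=> //.
  by apply/addk_none_between => Z _ c; rewrite B0.
by move=> Y Yu; apply/none_between_addk => // a c; rewrite B0.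
Qed.
End TwoRows.

Lemma planar_attach_max lam k r U B :
  is_part (behead lam) -> size (behead lam) <= 1 ->
  shape U \in behead lam :: remove_cell (behead lam) ->
  planar_tableau (attach_max lam k r U B) <->
  if shape U == behead lam then planar_rows (rcons r (k |` B)%fset) (row1 U)
  else planar_rows r (rcons (row1 U) (k |` B)%fset).
Proof.
move=> plam sz shU; have szU : size U <= 1.
  rewrite -(size_map size) -/(shape U); move: shU;
    rewrite inE => /predU1P[->//|].
  by move/(size_remove_cell plam)/leq_trans; apply.
rewrite /attach_max; case: ifP shU => [_ _|/negbT nU].
  by split=> [/planar_tableauP[]|h] //; apply/planar_tableauP.
rewrite inE (negbTE nU) => /(shape_place (k |` B)%fset plam) => shp.
have -> : place (k |` B)%fset U (behead lam) = [:: rcons (row1 U) (k |`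
  B)%fset].
  case: U szU shp {nU} => [|u [|]] //= _; case: ifP => // _ E.
  by move: sz; rewrite -E.
by split=> [/planar_tableauP[]|h] //; apply/planar_tableauP.
Qed.

(** A bump creates a third row, so planarity of [phi_tab] includes that [B] is
    appended to the second row. *)
Lemma planar_phi_tab k n r U B :
  core k n r U B -> size U <= 1 ->
  planar_tableau (phi_tab r U B) <->
  if B == fset0 then planar_rows r (row1 U)
  else all (set_lt^~ B) (row1 U) /\ planar_rows r (rcons (row1 U) B).
Proof.
move=> /core_keys ck szU; rewrite /phi_tab; case: ifP => [_|/negbT B0].
  rewrite -planar_rows_blank.
  by split=> [/planar_tableauP[]|h] //; apply/planar_tableauP.
have /andP[+ _] := ck B0; rewrite /keys.
case: U szU {ck} => [|u [|]] // _ fr;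
  first by split=> [/planar_tableauP[]|[_ h]] //; apply/planar_tableauP.
rewrite /= cats0 in fr.
case: row_insertP fr => [{}u h|u1 y u2 h xy] fr.
  split=> [/planar_tableauP[] _ ?|[_ ?]]; last by apply/planar_tableauP.
  by split=> //; apply: fresh_lt.
split=> [/planar_tableauP[]|[]] //=; rewrite all_cat /= => /and3P[_ + _].
by rewrite /set_lt ltnNge ltnW.
Qed.

Lemma planar_core k n lam r U B :
  0 < k -> core k n r U B -> is_part (behead lam) -> size (behead lam) <= 1 ->
  shape U \in behead lam :: remove_cell (behead lam) ->
  planar_tableau (attach_max lam k r U B) = planar_tableau (phi_tab r U B).
Proof.
move=> k0 cr plam sz shU; have szU : size U <= 1.
  rewrite -(size_map size) -/(shape U); move: shU;
    rewrite inE => /predU1P[->//|].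
  by move/(size_remove_cell plam)/leq_trans; apply.
have fU : flatten U = row1 U by case: U szU {cr shU} => [|u [|]] //= _;
  rewrite cats0.
have [_ _ U0 lt _] := cr; rewrite fU in U0 lt.
have below : {in B :: r ++ row1 U, forall Z c, c \in Z -> c < k}.
  by move=> Z Zin c cZ; have := occ_gt0 Zin cZ; rewrite lt; lia.
have disj : {in r ++ row1 U, forall Z c, c \in B -> c \notin Z}.
  move=> Z Zin c cB; apply/negP => cZ; have := lt c; have := occ_gt0 Zin cZ.
  by rewrite occ_cons cB; lia.
have ET := planar_attach_max k r B plam sz shU;
  have ES := planar_phi_tab cr szU.
apply/idP/idP => [/ET|/ES] h; [apply/ES|apply/ET]; move: h.
  case: ifP => _; case: eqP => [B0|/eqP B0].
  - exact: (planar_rows_first0 below B0).1.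
  - exact: (planar_rows_first below disj U0 B0).1.
  - exact: (planar_rows_second0 below B0).1.
  - exact: (planar_rows_second below disj U0 B0).1.
case: eqP => [B0|/eqP B0]; case: ifP => _.
- exact: (planar_rows_first0 below B0).2.
- exact: (planar_rows_second0 below B0).2.
- exact: (planar_rows_first below disj U0 B0).2.
- exact: (planar_rows_second below disj U0 B0).2.
Qed.

Lemma planar_size A T :
  planar_family A -> tableau_in A T -> size (behead (shape T)) <= 1.
Proof.
move=> pA; rewrite tableau_inE pA => /andP[_ /and3P[sz _ _]].
by rewrite size_behead size_map; lia.
Qed.

Lemma tableau_in_core A k n lam r U B :
  0 < k -> core k n r U B -> is_part (behead lam) ->
  (planar_family A -> size (behead lam) <= 1) ->
  shape U \in behead lam :: remove_cell (behead lam) ->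
  tableau_in A (attach_max lam k r U B) =
  tableau_in A (phi_tab r U B) && allowed A (B == fset0) (shape U == behead
    lam).
Proof.
move=> k0 cr plam sz shU; have [kB _ _] := core_notin k0 cr.
rewrite !tableau_inE sizes_in_core // -!andbA [allowed _ _ _ && _]andbC.
case: (planar_family A) sz => //= /(_ isT) sz.
by rewrite (planar_core k0 cr plam sz shU).
Qed.

(** * Counting the fiber *)

(** If the entries below the first row are singletons, then their number and the
    total size of the entries of the first row add up to [k]. *)
Lemma SMTA_irr_index A k n lam T :
  part_of n lam -> 0 < n -> SMTA A lam k T -> irr_index A k (behead lam).
Proof.
move=> plam n0 /andP[smt inA];
  have [r [W [ET sz lt sr [stdW W0]]]] := SMT_elim plam n0 smt.
have shT : shape T = lam by case/and4P: smt => /eqP.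
have shW : shape W = behead lam by rewrite -shT ET.
have sW : sumn (behead lam) = size (flatten W) by rewrite size_flatten shW.
have [_ le] := size_le_blanks lt W0.
have pl : planar_family A -> size (behead lam) <= 1 by move=> pA;
  rewrite -shT (planar_size pA inA).
have plam' : is_part (behead lam) by case/andP: plam => /is_part_behead.
have sum := sum_card_letters lt; rewrite big_cat /= in sum.
have sumW : matching_tableau T ->
  \sum_(X <- flatten W) #|` X| = sumn (behead lam).
  rewrite ET /matching_tableau /= all_rows_flatten => /andP[_ /allP h].
  rewrite sW -sum1_size; apply: eq_big_seq => X /h /eqP //.
have sumr d : row1_sizes [:: 0; d] T -> d %| \sum_(X <- r) #|` X|.
  rewrite ET /row1_sizes /= => /allP h; rewrite big_seq;
    apply: dvdn_sum => X /h.
  by rewrite !inE => /orP[] /eqP->.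
have rest d : matching_tableau T -> row1_sizes [:: 0; d] T ->
    d %| k - size (flatten W).
  by move=> /sumW E1 /sumr; rewrite -sum E1 sW addnK.
rewrite /irr_index plam' sW le; case: A inA pl => //=.
- by case/andP=> mT s0; rewrite eqn_leq le -subn_eq0 -dvd0n => _;
    apply: (rest 0 mT); rewrite /row1_sizes; apply: sub_all s0 => X;
    rewrite !inE => ->.
- by case/andP=> mT s2 _; rewrite -dvdn2 rest.
- by case/and3P=> mT _ s2 ->//; rewrite -dvdn2 rest.
- by move=> _ ->.
- by move=> _ ->.
- by move=> _ ->.
Qed.

(** The cases [nu' = nu], [nu'] one cell smaller and [nu'] one cell larger
    exclude each other by size, so that a disjunction in a branching rule is a
    sum over the admissible [rho]. *)
Lemma branchingE A nu' nu :
  is_part nu' -> is_part nu ->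
  branching A nu' nu =
  count (fun rho => ((nu' == rho) || (rho \in remove_cell nu')) &&
                    allowed A (rho == nu') (rho == nu)) (nu :: remove_cell nu).
Proof.
move=> pnu' pnu.
have tail (P : bool -> bool) : P false = false ->
    count (fun rho => ((nu' == rho) || (rho \in remove_cell nu')) && P (rho ==
      nu'))
      (remove_cell nu) = P true && (nu' \in remove_cell nu).
  move=> P0; case P1: (P true); last first.
    by rewrite (@eq_count _ _ pred0) ?count_pred0 // => rho;
      case: (rho == nu'); rewrite ?P0 ?P1 ?andbF.
  rewrite -count_uniq_mem ?remove_cell_uniq //; apply: eq_count => rho /=.
  by rewrite eq_sym; case: (rho == nu') => //=; rewrite ?P1 ?P0 ?andbF ?andbT.
have first (P : bool -> bool -> bool) :
    count (fun rho => ((nu' == rho) || (rho \in remove_cell nu')) && P (rho ==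
      nu') (rho == nu))
      (remove_cell nu) =
    count (fun rho => ((nu' == rho) || (rho \in remove_cell nu')) && P (rho ==
      nu') false)
      (remove_cell nu).
  apply: eq_in_count => rho rin; have [E|//] := eqVneq rho nu.
  by move: rin; rewrite E (negbTE (remove_cell_irrefl pnu)).
have ab : nu \in remove_cell nu' -> (nu == nu') = false.
  by move=> h; apply: contraTF h => /eqP->; apply: remove_cell_irrefl.
have ac : nu' \in remove_cell nu -> (nu == nu') = false.
  by move=> h; apply: contraTF h => /eqP->; apply: remove_cell_irrefl.
have bc : nu \in remove_cell nu' -> nu' \in remove_cell nu = false.
  move=> /(sumn_remove_cell pnu') h; apply/negP => /(sumn_remove_cell pnu); lia.
case h: (allowed A false false).
  by case: A h => //= _; congr (_ + _); rewrite ?andbT //;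
    apply: eq_count => rho; rewrite andbT.
rewrite [RHS]/= first eqxx (tail (fun b => allowed A b false) h) {first tail}.
move: ab ac bc; rewrite [nu' == nu]eq_sym.
case: A h => //= _; rewrite ?[nu' == nu]eq_sym;
  case: (nu \in remove_cell nu'); case: (nu == nu');
    case: (nu' \in remove_cell nu) => //=;
  try (by move=> /(_ isT)); try (by move=> _ /(_ isT)); by move=> _ _ /(_ isT).
Qed.

Lemma number_of_bij (R : seq (seq nat)) (P : tableau -> Prop) (g :
  tableau -> seq nat) :
  uniq R -> (forall T, P T -> g T \in R) ->
  (forall T1 T2, P T1 -> P T2 -> g T1 = g T2 -> T1 = T2) ->
  (forall rho, rho \in R -> exists2 T, P T & g T = rho) ->
  number_of P (size R).
Proof.
elim: R P => [|rho R IH] P /= unR gin inj surj.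
  by exists fset0; rewrite ?cardfs0 // => T; split=> // /gin.
case/andP: unR => rhoR unR; have [T PT gT] := surj rho (mem_head _ _).
case: (IH (fun T' => P T' /\ g T' != rho)) =>
  // [T' [/gin +]|T1 T2 [P1 _] [P2 _]|rho' rin|F hF cF].
- by rewrite inE => /orP[->|].
- exact: inj.
- have [|T' PT' gT'] := surj rho'; first by rewrite inE rin orbT.
  by exists T' => //; split=> //; rewrite gT'; apply: contraNneq rhoR => <-.
exists (T |` F)%fset.
  move=> T'; rewrite !inE; split=> [/predU1P[->//|/hF[]//]|PT'].
  have [E|ne] := eqVneq (g T') rho; first by rewrite (inj T' T) ?gT ?E ?eqxx.
  by apply/orP; right; apply/hF.
rewrite cardfsU1 cF; suff -> : T \notin F by [].
by apply/negP => /hF[_]; rewrite gT eqxx.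
Qed.

Lemma core_part k n r U B :
  0 < k -> 2 * k <= n -> core k n r U B -> is_part (shape (r :: U)).
Proof.
move=> k0 kn [_ stdU U0 lt sz]; rewrite /= is_part_cons standard_part // andbT.
have [_ le] := @size_le_blanks k.-1 (B :: r) _ lt U0.
by rewrite -size_row1_shape; have := size_row1_flatten U; lia.
Qed.

Theorem theorem6p13 (k n : nat) (A : algebra_family) (lam mu : seq nat) :
  0 < k -> 2 * k <= n -> part_of n lam -> part_of n mu ->
  (forall (T S : tableau) (tau : seq nat),
     SMTA A lam k T -> phi k T = (S, tau) -> shape S = mu ->
     SMTA A mu k.-1 S) /\
  (forall S : tableau, SMTA A mu k.-1 S ->
     let fiber (T : tableau) :=
       SMTA A lam k T /\ exists2 tau, is_part tau & phi k T = (S, tau) in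
     number_of fiber (rule_edges A k (behead mu) (behead lam)) /\
     (forall (C : numClosedFieldType)
             (V : forall j, seq nat -> diagram_rep C j),
        standard_labelling A n V k ->
        exists2 m, bratteli_edges A n V k (behead mu) (behead lam) m
                 & number_of fiber m)).
Proof.
move=> k0 kn plam pmu; have n0 : 0 < n by lia.
have plam' : is_part (behead lam) by case/andP: plam => /is_part_behead.
have pmu' : is_part (behead mu) by case/andP: pmu => /is_part_behead.
have decomp T : SMTA A lam k T -> exists r U B,
    [/\ core k n r U B, T = attach_max lam k r U B,
      shape U \in behead lam :: remove_cell (behead lam) &
      tableau_in A (phi_tab r U B) && allowed A (B == fset0) (shape U == behead
        lam)].
  case/andP=> smt inA; have [r [U [B [cr ET shU]]]] := core_of_SMT k0 kn plam
    smt.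
  exists r, U, B; split=> //;
    rewrite -(tableau_in_core k0 cr plam') // -?ET // => pA.
  by case/and4P: smt => /eqP <- _ _ _; apply: planar_size inA.
split=> [T S tau /decomp[r [U [B [cr -> shU /andP[inS _]]]]]|S SA fiber].
  rewrite (phi_attach_max _ k0 kn cr) => -[<- _] shS; rewrite /SMTA inS andbT.
  by have [] := SMT_phi_tab k0 kn pmu cr shS.
have irr' : irr_index A k.-1 (behead mu) by apply: (SMTA_irr_index pmu n0 SA).
have main : number_of fiber (rule_edges A k (behead mu) (behead lam)).
  rewrite /rule_edges irr' /=; case: ifP => irr; last first.
    exists fset0; rewrite ?cardfs0 // => T;
      split=> // -[/(SMTA_irr_index plam n0)].
    by rewrite irr.
  have planar1 : planar_family A -> size (behead lam) <= 1.
    by move: irr; rewrite /irr_index; case: (A) => //= /and3P[] // _ /andP[].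
  have /andP[smtS inS] := SA;
    have shS : shape S = mu by case/and4P: smtS => /eqP.
  rewrite branchingE // -size_filter.
  apply: (@number_of_bij _ _ (fun T => behead (phi k T).2)).
  - rewrite filter_uniq //= remove_cell_uniq // andbT.
    exact: remove_cell_irrefl.
  - move=> T [/decomp[r [U [B [cr -> shU /andP[_ al]]]]] [tau _]].
    rewrite (phi_attach_max _ k0 kn cr) => -[ES _].
    rewrite mem_filter [behead (_, _).2]/= shU andbT.
    have [] := SMT_phi_tab k0 kn pmu cr; rewrite ?ES // => _.
    move: al; case: ifP => _ al.
      by move=> EU; move: al; rewrite EU !eqxx.
    move=> rin; rewrite rin orbT /=;
      suff -> : (shape U == behead mu) = false by [].
    by apply: contraTF rin => /eqP->; apply: remove_cell_irrefl.
  - move=> T1 T2 [/decomp[r1 [U1 [B1 [cr1 -> _ _]]]] [tau1 _]].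
    rewrite (phi_attach_max _ k0 kn cr1) => -[ES1 _].
    case=> /decomp[r2 [U2 [B2 [cr2 -> _ _]]]] [tau2 _].
    rewrite (phi_attach_max _ k0 kn cr2) => -[ES2 _] /= sh.
    by have [|-> -> ->] := core_inj cr1 cr2 sh; rewrite // ES1.
  move=> rho; rewrite mem_filter => /andP[/andP[rmu al] rlam].
  have rmu' : rho \in behead mu :: remove_cell (behead mu)
    by rewrite inE eq_sym.
  have [r [U [B [cr shU ES EB]]]] := core_of_phi_image k0 kn pmu smtS rmu'.
  rewrite -shU in rlam al EB.
  exists (attach_max lam k r U B); last by rewrite (phi_attach_max _ k0 kn cr).
  split; last first.
    by exists (shape (r :: U));
      rewrite ?(phi_attach_max _ k0 kn cr) ?ES // (core_part k0 kn cr).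
  rewrite /SMTA (SMT_attach_max k0 kn plam cr) //=.
  by rewrite (tableau_in_core k0 cr plam' planar1) // -ES inS EB.
split=> // C V [_ _ h]; exists (rule_edges A k (behead mu) (behead lam)) => //.
rewrite /rule_edges; case: ifP => [/andP[i1 i2]|ni]; first exact: h.
by rewrite /bratteli_edges ni.
Qed.
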